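(* Let $n$ be a positive integer, let $N = \binom{n+1}{2}$, and let $\rho_n = (n, n-1, n-2, \ldots, 1)$ be the staircase partition of $N$. Then the tensor cube $\left(S^{\rho_n}\right)^{\otimes 3} = S^{\rho_n} \otimes S^{\rho_n} \otimes S^{\rho_n}$ contains every irreducible representation of the symmetric group $S_N$ as a subrepresentation; that is, for every partition $\lambda$ of $N$, $S^\lambda$ is isomorphic to a subrepresentation of $S^{\rho_n} \otimes S^{\rho_n} \otimes S^{\rho_n}$.
   Context: Representations are finite-dimensional ordinary (characteristic zero, say over $\mathbb{C}$) representations. For a partition $\lambda$ of $N$, $S^\lambda$ denotes the irreducible representation (Specht module) of the symmetric group $S_N$ indexed by $\lambda$, with the usual convention that $S^{(N)}$ is the trivial representation. Tensor products are inner (Kronecker) tensor products: $S_N$ acts diagonally. *)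

(* Defs.v *)
From HB Require Import structures.
From mathcomp Require Import all_boot all_order all_algebra all_fingroup.
From mathcomp Require Import all_solvable all_field all_character.

Set Implicit Arguments.
Unset Strict Implicit.
Unset Printing Implicit Defensive.

Import GRing.Theory.
Local Open Scope ring_scope.

Definition is_partition (N : nat) (sh : seq nat) : bool :=
  [&& sorted geq sh, 0%N \notin sh & sumn sh == N].

Definition staircase (n : nat) : seq nat := rev (iota 1 n).

Definition symgroup (N : nat) : {group 'S_N} := [set: 'S_N]%G.

(* When sumn sh = N, the cells of the diagram of sh are numbered by 'I_N in
   reading order: k lies in row reshape_index sh k and column
   reshape_offset sh k. This is the standard tableau filled row by row. *)
Definition row_stab (N : nat) (sh : seq nat) : {set 'S_N} :=
  [set p : 'S_N | [forall k : 'I_N,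
     reshape_index sh (p k) == reshape_index sh k]].

Definition col_stab (N : nat) (sh : seq nat) : {set 'S_N} :=
  [set p : 'S_N | [forall k : 'I_N,
     reshape_offset sh (p k) == reshape_offset sh k]].

(* Elements of the group algebra are represented, as in mxrepresentation, by
   their matrices in the regular representation. *)
Definition young_symmetrizer (F : fieldType) (N : nat) (sh : seq nat) :
    'M[F]_#|symgroup N| :=
  let aG := regular_repr F (symgroup N) in
  (\sum_(p in row_stab N sh) aG p)
    *m (\sum_(q in col_stab N sh) (-1) ^+ odd_perm q *: aG q).

(* The Specht module is the submodule of the (right) regular module generated
   by the Young symmetrizer. The right translates of
   \sum_(p in row_stab N sh) p correspond to the cosets of row_stab N sh, that
   is, to the tabloids of shape sh; under this identification the generator is
   the polytabloid of the tableau above, and its translates are all the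
   polytabloids of shape sh. *)
Definition specht_mx (F : fieldType) (N : nat) (sh : seq nat) :
    'M[F]_#|symgroup N| :=
  cyclic_mx (regular_repr F (symgroup N))
            (gring_row (young_symmetrizer F N sh)).

Definition specht (F : fieldType) (N : nat) (sh : seq nat) :
    mx_representation F (symgroup N) (\rank (specht_mx F N sh)) :=
  submod_repr (cyclic_mx_module (regular_repr F (symgroup N))
                 (gring_row (young_symmetrizer F N sh))).

Definition is_subrepr (F : fieldType) (gT : finGroupType) (G : {group gT})
    (m n : nat) (rV : mx_representation F G m) (rW : mx_representation F G n) :
    Prop :=
  exists (U : 'M[F]_n) (modU : mxmodule rW U), mx_rsim rV (submod_repr modU).

(* Main.v *)
Require Import Defs.
From HB Require Import structures.
From mathcomp Require Import all_boot all_order all_algebra all_fingroup.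
From mathcomp Require Import all_solvable all_field all_character.
From mathcomp Require Import zify.

Set Implicit Arguments.
Unset Strict Implicit.
Unset Printing Implicit Defensive.

Import GRing.Theory.
Local Open Scope ring_scope.

(** Write e = a b for the Young symmetrizer, where a is the sum of the row group
    R of a diagram and b the alternating sum of its column group C; it acts as
    a nonzero operator on a module exactly when the module contains the Specht
    module. Let V be the Specht module of the staircase and S that of any shape.
    The trace of e is, up to a nonzero factor, an inner product of characters
    ([opf_ycoef_pairing]), and Specht characters are invariant under inversion,
    so it suffices that the staircase symmetrizer acts as a nonzero operator on
    V (x) W, where W = V (x) S ([ycoef_staircase_tensor]). This has three parts.

    First, if w is an R-invariant vector of W whose sum over C is nonzero, then
    e is nonzero on V (x) W: apply b to v (x) w, with v an R-invariant vector of
    V not killed by b, and then b again to the first factor only; the signs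
    cancel and the result is v b (x) (w summed over C) ([ycoef_tensor]).

    Second, summing over C is injective on the R-invariants of any module, for
    the staircase ([staircase_row_to_col]). Invariants of Young subgroups are
    equivariant functions on colourings of the N positions, and on such
    functions the general linear Lie algebra acts by changing one colour at a
    time. Summing over C replaces, one cell after another, row colours by column
    colours; in a suitable order of the cells of the staircase, each of these
    operators turns a colour used d + 1 times into one used d times, and is
    injective by the representation theory of sl2 ([hop_injective]).

    Third, W has nonzero R-invariants ([row_invariant_exists]). The staircase is
    a 2-core, so the character of V, and hence that of W, vanishes on elements
    of even order ([staircase_char_even_order]). This forces an alternating sum
    of dimensions of invariants, over the ways to split two parts k, k into two
    parts, to vanish; with the injectivity above, invariants of type (..., k, k)
    yield invariants of type (..., k + 1, k - 1) ([void_double]). Starting from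
    the trivial group, of type (1, ..., 1), such steps lead to the staircase
    ([void_staircase]).

    The vanishing on elements of even order is itself proved in two steps. Over
    the integers e e = h e, and h is odd: modulo two, sweeping the cells of the
    staircase and sweeping back is the identity on highest weight functions
    ([unsweep]), which says that e is idempotent ([yscalar_F2]). Then, e being
    proportional to its powers of exponent 2 ^ m, its coefficient sum over a
    class of elements of even order is a sum over words of length 2 ^ m, and
    rotating the words shows that it is divisible by arbitrarily large powers of
    two ([odd_quasi_idem_sum]). *)

(** * Colourings and the operators that change one colour *)

Section Colourings.

Variables (N : nat) (L : eqType).

Notation colouring := {ffun 'I_N -> L}.

Definition recolour (x : colouring) (p : 'I_N) (l : L) : colouring :=
  [ffun q => if q == p then l else x q].

(** The inverse makes this a right action, to match the right modules of
    matrix representations. *)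
Definition pull (x : colouring) (g : 'S_N) : colouring :=
  [ffun q => x (g^-1%g q)].

Definition ncol (l : L) (x : colouring) : nat := #|[pred p | x p == l]|.

Lemma pullE x g q : pull x g (g q) = x q.
Proof. by rewrite ffunE permK. Qed.

Lemma pull1 x : pull x 1 = x.
Proof. by apply/ffunP=> q; rewrite ffunE invg1 perm1. Qed.

Lemma pullM x g k : pull x (g * k)%g = pull (pull x g) k.
Proof. by apply/ffunP=> q; rewrite !ffunE invMg permM. Qed.

Lemma pull_inj g : injective (pull^~ g).
Proof.
by move=> x y xy; rewrite -[x]pull1 -[y]pull1 -(mulgV g) !pullM xy.
Qed.

Lemma pull_fixP (x : colouring) (g : 'S_N) :
  reflect (forall q, x (g q) = x q) (pull x g == x).
Proof.
apply: (iffP eqP) => [xg q|xg]; first by rewrite -{1}xg pullE.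
by apply/ffunP=> q; rewrite ffunE -{2}(permKV g q) xg.
Qed.

Lemma pull_recolour x p l g :
  pull (recolour x p l) g = recolour (pull x g) (g p) l.
Proof.
by apply/ffunP=> q; rewrite !ffunE (canF_eq (permKV g)).
Qed.

Lemma recolour_same x p : recolour x p (x p) = x.
Proof. by apply/ffunP=> q; rewrite ffunE; case: eqP => // ->. Qed.

Lemma recolourK x p l l' : recolour (recolour x p l) p l' = recolour x p l'.
Proof. by apply/ffunP=> q; rewrite !ffunE; case: eqP. Qed.

Lemma recolourC x p q l l' : p != q ->
  recolour (recolour x p l) q l' = recolour (recolour x q l') p l.
Proof.
move=> pq; apply/ffunP=> z; rewrite !ffunE.
by case: (eqVneq z q) => // ->; rewrite eq_sym (negPf pq).
Qed.

Lemma ncol_pull l x g : ncol l (pull x g) = ncol l x.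
Proof.
rewrite /ncol -!sum1_card (reindex_inj (@perm_inj _ g)) /=.
by apply: eq_bigl => q; rewrite !inE pullE.
Qed.

Lemma ncol_gt0 l (x : colouring) p : x p = l -> (0 < ncol l x)%N.
Proof. by move=> xp; apply/card_gt0P; exists p; rewrite inE xp. Qed.

Lemma ncol_recolour l (x : colouring) p b :
  (ncol l (recolour x p b) + (x p == l) = ncol l x + (b == l))%N.
Proof.
rewrite /ncol (cardD1 p) [in RHS](cardD1 p) !inE ffunE eqxx.
rewrite [LHS]addnC addnA [RHS]addnAC; congr addn.
by apply: eq_card => q; rewrite !inE ffunE; case: eqP.
Qed.

Lemma pull_transitive (x y : colouring) :
  (forall l, ncol l x = ncol l y) -> exists g, y = pull x g.
Proof.
move=> xy; pose tup (z : colouring) := [tuple z i | i < N].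
have cnt (z : colouring) l : count_mem l (tup z) = ncol l z.
  by rewrite -sum1_count big_map big_enum_cond /= /ncol -sum1_card; apply: eq_bigl.
have /tuple_permP[g gP] : perm_eq (tup y) (tup x).
  by apply/allP=> l _; apply/eqP; rewrite !cnt xy.
exists g^-1%g; apply/ffunP=> q; rewrite ffunE invgK.
have /(congr1 (fun s => tnth s q)) : tup y = [tuple tnth (tup x) (g i) | i < N].
  exact: val_inj.
by rewrite !tnth_mktuple.
Qed.

Section Hop.

Variable V : zmodType.
Implicit Types (f : colouring -> V) (x y : colouring) (a b c d s t : L).

(** On the tensor power of the span of L, whose basis consists of colourings,
    this is the transpose of the action of a matrix unit of gl(L). *)
Definition hop a b f y : V := \sum_(p | y p == a) f (recolour y p b).

Definition hop2 a b c d f y : V :=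
  \sum_(p | y p == a) \sum_(q | (q != p) && (y q == c))
     f (recolour (recolour y p b) q d).

Lemma eq_hop a b f f' : f =1 f' -> hop a b f =1 hop a b f'.
Proof. by move=> ff y; apply: eq_bigr => p _; apply: ff. Qed.

Lemma hop_same a f y : hop a a f y = f y *+ ncol a y.
Proof.
rewrite /hop (eq_bigr (fun=> f y)) => [|p /eqP <-]; last by rewrite recolour_same.
by rewrite sumr_const.
Qed.

Lemma hopD a b f f' y : hop a b (fun x => f x + f' x) y = hop a b f y + hop a b f' y.
Proof. exact: big_split. Qed.

Lemma hop0 a b f y : f =1 (fun=> 0) -> hop a b f y = 0.
Proof. by move=> f0; apply: big1 => p _. Qed.

Lemma hop_pull a b f g y :
  hop a b (fun x => f (pull x g)) y = hop a b f (pull y g).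
Proof.
rewrite /hop [RHS](reindex_inj (@perm_inj _ g)) /=.
by apply: eq_big => p; rewrite ?pullE // pull_recolour.
Qed.

Lemma hop2C a b c d f y : hop2 a b c d f y = hop2 c d a b f y.
Proof.
rewrite /hop2 (exchange_big_dep (fun q => y q == c)) /= => [|p q _ /andP[]//].
apply: eq_bigr => q yq; apply: eq_big => p; first by rewrite yq andbT andbC (eq_sym q).
by case/and3P => _ qp _; rewrite recolourC // eq_sym.
Qed.

(** The two hops happen at the same position, where they compose as matrix
    units do, or at two positions, in a way that does not depend on the order.
    The operators hop thus satisfy the relations of the Lie algebra gl(L). *)
Lemma hop_hop a b c d f y :
  hop a b (hop c d f) y = (if b == c then hop a d f y else 0) + hop2 a b c d f y.
Proof.
rewrite {1}/hop (eq_bigr (fun p => (if b == c then f (recolour y p d) else 0) +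
  \sum_(q | (q != p) && (y q == c)) f (recolour (recolour y p b) q d))).
  by rewrite big_split /=; congr (_ + _); case: ifP => // _; rewrite big1.
move=> p _; rewrite {1}/hop (bigID (pred1 p)) /=; congr (_ + _).
  rewrite big_mkcondl big_pred1_eq ffunE eqxx.
  by case: ifP => // _; rewrite recolourK.
apply: eq_bigl => q; rewrite ffunE andbC; by case: (eqVneq q p).
Qed.

Lemma hop_comm a b c d f y :
  hop a b (hop c d f) y + (if d == a then hop c b f y else 0) =
  hop c d (hop a b f) y + (if b == c then hop a d f y else 0).
Proof. by rewrite !hop_hop hop2C addrC [RHS]addrC addrCA. Qed.

End Hop.

Section HopFacts.

Variable V : zmodType.
Implicit Types (f g : colouring -> V) (x y : colouring) (a b c s t : L).

Lemma hop_neq0 a b f y : hop a b f y != 0 ->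
  exists p, y p = a /\ f (recolour y p b) != 0.
Proof.
move=> nz; have [p /andP[/eqP yp fp]|none] :=
  pickP (fun p => (y p == a) && (f (recolour y p b) != 0)).
  by exists p.
case/eqP: nz; apply: big1 => p yp; apply/eqP; have := none p.
by rewrite yp /= => /negbFE.
Qed.

Lemma ncol_recolour_neq l y p b : y p != b ->
  (ncol l (recolour y p b) =
     if l == b then (ncol l y).+1
     else if l == y p then (ncol l y).-1 else ncol l y).
Proof.
move=> ypb; have := ncol_recolour l y p b; rewrite ![_ == l]eq_sym.
case: (eqVneq l b) => [->|lb]; first by rewrite eq_sym (negPf ypb) /=; lia.
case: (eqVneq l (y p)) => [lp|_] /=; last by lia.
by have : (0 < ncol l y)%N := ncol_gt0 (esym lp); lia.
Qed.

(** The relation [E, F] = H of sl2. *)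
Lemma hop_commutator s t f y d :
    (f y != 0 -> ncol s y = (ncol t y + d)%N) ->
  hop t s (hop s t f) y + f y *+ d = hop s t (hop t s f) y.
Proof.
move=> fd; have := hop_comm t s s t f y; rewrite !eqxx !hop_same.
have [->|/fd ->] := eqVneq (f y) 0; first by rewrite !mul0rn !addr0.
by rewrite mulrnDr addrA addrAC => /addIr.
Qed.

(** The representation theory of sl2: a nonzero function killed by the raising
    operator hop t s, of negative weight -d, would generate under hop s t an
    infinite string of nonzero functions, in which the number of positions of
    colour s grows without bound. *)
Lemma hop_injective s t d f :
    (forall (v : V) k, (0 < k)%N -> v *+ k = 0 -> v = 0) ->
    s != t -> (0 < d)%N ->
    (forall x, f x != 0 -> ncol s x = (ncol t x + d)%N) ->
  hop t s f =1 (fun=> 0) -> f =1 (fun=> 0).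
Proof.
move=> Vtf st d_gt0 fd f0; pose g k := iter k (hop s t) f.
have gd k x : g k x != 0 -> (ncol s x = ncol t x + (d + 2 * k))%N.
  elim: k => [|k IHk] in x *; first by rewrite muln0 addn0; apply: fd.
  case/hop_neq0=> p [xp /IHk].
  have xpt : x p != t by rewrite xp.
  rewrite !ncol_recolour_neq // xp !eqxx (negPf st).
  by have := ncol_gt0 xp; lia.
(* E F^(k+1) f is a negative multiple of F^k f, where E = hop t s and F = hop s t *)
have string k : exists2 c, (0 < c)%N &
    forall y, hop t s (g k.+1) y + g k y *+ c = 0.
  elim: k => [|k [c c_gt0 IHk]].
    exists d => // y; rewrite /g /= (hop_commutator (d := d)) //; last exact: fd.
    exact: hop0.
  exists (d + 2 * k.+1 + c)%N => [|y]; first by lia.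
  have := hop_commutator (@gd k.+1 y).
  rewrite -/(g k.+2) [_ *+ (_ + c)]mulrnDr addrA => ->.
  rewrite [g k.+1 y]/(hop s t (g k) y).
  rewrite (_ : hop s t (g k) y *+ c = hop s t (fun x => g k x *+ c) y).
    by rewrite -hopD hop0.
  by rewrite /hop sumrMnl.
have gN : g N.+1 =1 (fun=> 0).
  move=> x; apply/eqP/negPn/negP => /gd.
  by have := max_card [pred p | x p == s]; rewrite card_ord -/(ncol s x); lia.
have down k : g k.+1 =1 (fun=> 0) -> g k =1 (fun=> 0).
  move=> gk y; have [c c_gt0 /(_ y)] := string k.
  by rewrite hop0 // add0r; apply: Vtf.
by elim: N.+1 gN => // k IHk /down.
Qed.

(** The square counts every pair of positions twice. *)
Lemma hop_square a b f y : (forall v : V, v + v = 0) -> a != b ->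
  hop a b (hop a b f) y = 0.
Proof.
move=> V2 ab; rewrite hop_hop eq_sym (negPf ab) add0r.
pose S p q := f (recolour (recolour y p b) q b).
rewrite /hop2 (eq_bigr (fun p => \sum_(q | (q != p) && (y q == a)) S p q)) //.
pose X := \sum_(p : 'I_N | y p == a) \sum_(q : 'I_N | (p < q)%N && (y q == a)) S p q.
rewrite -[RHS](V2 X) {1}/X.
rewrite (eq_bigr (fun p : 'I_N => (\sum_(q : 'I_N | (p < q)%N && (y q == a)) S p q) +
                           (\sum_(q : 'I_N | (q < p)%N && (y q == a)) S p q))).
  rewrite big_split /=; congr (_ + _).
  rewrite (exchange_big_dep (fun q => y q == a)) /= => [|p q _ /andP[]//].
  apply: eq_bigr => q yq; apply: eq_big => p; first by rewrite yq andbT andbC.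
  by case/and3P=> _ qp _; rewrite /S recolourC // neq_ltn qp orbT.
move=> p _; rewrite (bigID (fun q : 'I_N => (p < q)%N)) /=.
by congr (_ + _); apply: eq_bigl => q; rewrite -(inj_eq val_inj) /= neq_ltn;
   case: ltngtP; rewrite ?andbF ?andbT.
Qed.

End HopFacts.

Section Chains.

Variable V : zmodType.
Implicit Types (f : colouring -> V) (x y u v : colouring).

Definition hops (l : seq (L * L)) f : colouring -> V :=
  foldr (fun ab g => hop ab.1 ab.2 g) f l.

Lemma eq_hops l f f' : f =1 f' -> hops l f =1 hops l f'.
Proof. by move=> ff; elim: l => //= ab l IHl; apply: eq_hop. Qed.

Lemma hops_pull l f g y :
  hops l (fun x => f (pull x g)) y = hops l f (pull y g).
Proof.
by elim: l y => //= ab l IHl y; rewrite (eq_hop _ _ IHl) hop_pull.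
Qed.

(** The subgroups of the stabiliser of v that only move positions already turned
    form a chain. When position p is turned, the hop sums over the positions q
    turned so far with v q = v p, and the transpositions of p and q represent
    the cosets of the preceding subgroup of the chain. *)
Lemma hops_symmetrize u v f (c : seq 'I_N) :
    (forall p q, u p != v q) -> uniq c -> (forall p, p \in c) ->
  hops [seq (v p, u p) | p <- c] f v =
  \sum_(g : 'S_N | pull v g == v) f (pull u g).
Proof.
move=> uv c_uniq c_all.
(* the positions in c have already received their letter of v *)
pose mix (c : seq 'I_N) : colouring := [ffun q => if q \in c then v q else u q].
pose St (c : seq 'I_N) (g : 'S_N) :=
  [forall z, (z \in c) || (g z == z)] && (pull v g == v).
suff main : hops [seq (v p, u p) | p <- c] f (mix c) =
            \sum_(g | St c g) f (pull u g).
  have mixv : mix c = v by apply/ffunP=> q; rewrite ffunE c_all.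
  rewrite -{2}mixv main; apply: eq_bigl => g; rewrite /St.
  by case: forallP => // -[] z; rewrite c_all.
elim: c c_uniq f {c_all} => [_ f|p c IHc /= /andP[pc c_uniq] f].
  rewrite /= (big_pred1 (1%g : 'S_N)) => [|g].
    by congr f; apply/ffunP=> q; rewrite !ffunE invg1 perm1.
  apply/idP/eqP=> [/andP[/forallP g1 _]|->].
    by apply/permP=> z; have /= /eqP-> := g1 z; rewrite perm1.
  by rewrite /St pull1 eqxx andbT; apply/forallP=> z; rewrite perm1 eqxx.
have mixE q : (mix (p :: c) q == v p) = (q \in p :: c) && (v q == v p).
  by rewrite ffunE; case: ifP; rewrite //= (negPf (uv _ _)).
rewrite [RHS](partition_big (fun k : 'S_N => k p)
          (fun q => mix (p :: c) q == v p)) /=; last first.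
  move=> k /andP[/forallP k1 /pull_fixP kv]; rewrite mixE kv eqxx andbT.
  have := k1 (k p); rewrite (inj_eq perm_inj) => /orP[//|/eqP->].
  exact: mem_head.
rewrite /hop; apply: eq_bigr => q; rewrite mixE => /andP[qpc /eqP vqp].
pose tau : 'S_N := tperm p q.
have -> : recolour (mix (p :: c)) q (u p) = pull (mix c) tau.
  apply/ffunP=> z; rewrite !ffunE tpermV /tau inE; case: tpermP => [->|->|].
  - have [pq|pq] := eqVneq p q; first by rewrite -pq (negPf pc).
    by move: qpc; rewrite inE (eq_sym q) (negPf pq) eqxx vqp => /= ->.
  - by rewrite eqxx (negPf pc).
  by move=> /eqP/negPf-> /eqP/negPf->.
rewrite -hops_pull IHc // [RHS](reindex_inj (mulIg tau)) /=.
apply: eq_big => [g|g _]; last by rewrite pullM.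
have vtau z : v (tau z) = v z by rewrite /tau; case: tpermP => [->|->|].
have tauD z : z != p -> z != q -> tau z = z.
  by move=> zp zq; rewrite /tau tpermD // eq_sym.
apply/idP/idP => [/andP[/forallP g1 /pull_fixP gv]|].
  have gp : g p = p by have := g1 p; rewrite (negPf pc) /= => /eqP.
  rewrite permM gp tpermL eqxx andbT; apply/andP; split.
    apply/forallP=> z; rewrite inE permM; have := g1 z.
    case: (eqVneq z p) => [//|zp] /=; case/orP => [->//|/eqP ->].
    have [zc|zc] := boolP (z \in c); first by [].
    rewrite tauD ?eqxx ?orbT //; apply: contraNneq zc => zq.
    by move: qpc zp; rewrite inE zq; case: eqVneq.
  by apply/pull_fixP=> z; rewrite permM vtau gv.
case/andP=> /andP[/forallP g1 /pull_fixP gv]; rewrite permM => /eqP gp.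
have {}gp : g p = p by apply: (can_inj (tpermK p q)); rewrite gp tpermL.
apply/andP; split; last first.
  by apply/pull_fixP=> z; rewrite -(gv z) permM vtau.
apply/forallP=> z; have := g1 z; rewrite inE permM.
case: (eqVneq z p) => [->|zp] /=; first by rewrite gp eqxx orbT.
case: (boolP (z \in c)) => //= zc /eqP gz.
have zq : z != q.
  apply: contraNneq zc => zq; move: qpc zp; rewrite inE zq.
  by case: eqVneq.
by apply/eqP/(can_inj (tpermK p q)); rewrite gz -/tau tauD.
Qed.

End Chains.

End Colourings.

(** * Sweeping a staircase *)

Section Sweep.

Variables (N : nat) (L : eqType) (n : nat) (s t : nat -> L).
Hypotheses (s_inj : injective s) (t_inj : injective t) (st : forall i j, s i != t j).

Notation colouring := {ffun 'I_N -> L}.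

(** The first k rows of the staircase n, ..., 1, listed backwards: as the last
    element of a list acts first in hops, rows are swept in increasing order
    and the cells of a row in decreasing order of their columns. *)
Fixpoint stair_cells (k : nat) : seq (nat * nat) :=
  if k is i.+1 then [seq (i, j) | j <- iota 0 (n - i)] ++ stair_cells i else [::].

Definition letters (c : seq (nat * nat)) : seq (L * L) :=
  [seq (t ij.1, s ij.2) | ij <- c].

(** The support of f consists of colourings with the content of the moment when
    the rows before i and the columns from j on in row i have been swept: every
    swept cell (k, m) has turned a letter s m into a letter t k. *)
Definition stage (V : zmodType) (i j : nat) (f : colouring -> V) : Prop :=
  forall x, f x != 0 ->
  [/\ forall m, ncol (s m) x = (n - m - i - (j <= m))%N,
      forall k, (i < k)%N -> ncol (t k) x = 0%N,
      ncol (t i) x = (n - i - j)%N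
    & forall k, (k < i)%N -> ncol (t k) x = (n - k)%N].

Section AnyTarget.

Variable V : zmodType.
Implicit Types (f g : colouring -> V).

Lemma stage_step i j f : (j < n - i)%N ->
  stage i j.+1 f -> stage i j (hop (t i) (s j) f).
Proof.
move=> jr fS y /hop_neq0[p [yp /fS[xs xt xti xtk]]].
have E l := ncol_recolour l y p (s j).
split=> [m|k ik||k ki].
- have := E (s m); rewrite xs yp eq_sym (negPf (st _ _)) (inj_eq s_inj).
  by case: (ltngtP j m) => /=; lia.
- have := E (t k); rewrite xt // yp (negPf (st _ _)) (inj_eq t_inj).
  by case: eqP; lia.
- have := E (t i); rewrite xti yp eqxx (negPf (st _ _)); lia.
- have := E (t k); rewrite xtk // yp (negPf (st _ _)) (inj_eq t_inj).
  by case: eqP; lia.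
Qed.

Lemma stage_next i f : (i < n)%N -> stage i 0 f -> stage i.+1 (n - i.+1) f.
Proof.
move=> ilt fS x /fS[xs xt xti xtk]; split=> [m|k ik||k].
- by rewrite xs; case: leqP; lia.
- by rewrite xt // ltnW.
- by rewrite xt // subnn.
by rewrite ltnS leq_eqVlt => /predU1P[->|/xtk//]; rewrite xti subn0.
Qed.

Lemma hops_cat l1 l2 f : hops (l1 ++ l2) f = hops l1 (hops l2 f).
Proof. by rewrite /hops foldr_cat. Qed.

Lemma hop_absent a b f :
  (forall x, f x != 0 -> ncol b x = 0%N) -> hop a b f =1 (fun=> 0).
Proof.
move=> f0 y; apply/eqP/negPn/negP => /hop_neq0[p [_ /f0]].
by apply/eqP; rewrite -lt0n (@ncol_gt0 _ _ _ _ p) // ffunE eqxx.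
Qed.

Lemma row_cellsS i d : (d < n - i)%N ->
  iota (n - i - d.+1) d.+1 = (n - i - d.+1)%N :: iota (n - i - d) d.
Proof. by move=> dr /=; congr (_ :: iota _ _); lia. Qed.

Lemma stage_row i d f : (d <= n - i)%N -> stage i (n - i) f ->
  stage i (n - i - d) (hops (letters [seq (i, j) | j <- iota (n - i - d) d]) f).
Proof.
move=> dr fS; elim: d dr => [|d IHd] dr; first by rewrite subn0.
rewrite row_cellsS // [letters _]/= [hops _ _]/=.
have jS : (n - i - d = (n - i - d.+1).+1)%N by lia.
by apply: stage_step; [lia | rewrite -jS; apply/IHd/ltnW].
Qed.

Lemma stage_sweep k f : (k <= n)%N -> stage 0 n f ->
  stage k (n - k) (hops (letters (stair_cells k)) f).
Proof.
move=> kn fS; elim: k kn => [|k IHk] kn /=; first by rewrite subn0.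
rewrite /letters map_cat hops_cat; apply: stage_next => //.
have := stage_row (leqnn _) (IHk (ltnW kn)); rewrite subnn; exact.
Qed.

(** When cell (i, j) is swept, n - i - j letters s j and n - i - j - 1 letters
    t i are present, so that hop_injective applies with d = 1. *)
Lemma sweep_injective f :
    (forall (v : V) k, (0 < k)%N -> v *+ k = 0 -> v = 0) -> stage 0 n f ->
  hops (letters (stair_cells n)) f =1 (fun=> 0) -> f =1 (fun=> 0).
Proof.
move=> Vtf fS; elim: {-2}n (leqnn n) => [//|i IHi] ilt /=.
rewrite /letters map_cat hops_cat => f0; apply: (IHi (ltnW ilt)).
move: (stage_sweep (ltnW ilt) fS) f0; move: (hops _ f) => g gS.
suff row_inj d : (d <= n - i)%N ->
    hops (letters [seq (i, j) | j <- iota (n - i - d) d]) g =1 (fun=> 0) ->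
    g =1 (fun=> 0).
  by have := row_inj _ (leqnn (n - i)%N); rewrite subnn; apply.
elim: d => [//|d IHd] dr.
rewrite row_cellsS // [letters _]/= [hops _ _]/= => g0.
apply: (IHd (ltnW dr)); apply: (hop_injective Vtf _ (ltn0Sn 0)) g0 => // x.
case/(stage_row (ltnW dr) gS) => xs _ -> _; rewrite xs.
by case: leqP; lia.
Qed.

(** Highest weight functions, killed by the raising operators of the source
    letters. *)
Definition highest f := forall a b, (a < b)%N -> hop (s a) (s b) f =1 (fun=> 0).

Definition swap_letters (l : seq (L * L)) := rev [seq (ab.2, ab.1) | ab <- l].

Lemma swap_letters_cat l1 l2 :
  swap_letters (l1 ++ l2) = swap_letters l2 ++ swap_letters l1.
Proof. by rewrite /swap_letters map_cat rev_cat. Qed.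

(** The operators that arise as commutators all kill the function reached so
    far: the raising operators hop (s a) (s b), the operators hop (t i) (s b)
    with b already swept, since squares vanish in characteristic two, and the
    operators hop (s a) (t i) with a not yet swept. So for the current cell only
    the Cartan element of the sl2 relation survives, and it acts as 1. *)
Lemma row_unsweep i d f : (forall v : V, v + v = 0) ->
    (d <= n - i)%N -> stage i (n - i) f -> highest f ->
  let l := letters [seq (i, j) | j <- iota (n - i - d) d] in
  [/\ highest (hops l f),
      forall b, (n - i - d <= b)%N -> hop (t i) (s b) (hops l f) =1 (fun=> 0),
      forall a, (a < n - i - d)%N -> hop (s a) (t i) (hops l f) =1 (fun=> 0)
    & hops (swap_letters l) (hops l f) =1 f].
Proof.
move=> V2 dr fS fH; elim: d dr => [|d IHd] dr.
  rewrite /= subn0; split=> // [b rb|a ar]; apply: hop_absent => x /fS[xs _ xt _].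
    by rewrite xs; lia.
  by rewrite xt subnn.
have gS := stage_row (ltnW dr) fS; have [gH gt gs gf] := IHd (ltnW dr).
rewrite row_cellsS // [letters _]/= /=.
move: gS gH gt gs gf; set l := letters _; set g := hops l f => gS gH gt gs gf.
have jS : (n - i - d = (n - i - d.+1).+1)%N by lia.
move: gS gt gs; rewrite jS; set j := (n - i - d.+1)%N => gS gt gs.
split=> [a b ab y|b jb y|a aj y|].
- have := hop_comm (s a) (s b) (t i) (s j) g y.
  rewrite (negPf (st _ _)) addr0 (inj_eq s_inj) [RHS]hop0 => [|z]; last exact: gH.
  have [ja|] := eqVneq j a; last by rewrite addr0.
  by rewrite gt ?addr0 // ja.
- move: jb; rewrite leq_eqVlt => /predU1P[<-|jb].
    by apply: hop_square; rewrite // eq_sym.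
  have := hop_comm (t i) (s b) (t i) (s j) g y.
  rewrite !(negPf (st _ _)) !addr0 => ->; apply: hop0; exact: gt.
- have := hop_comm (s a) (t i) (t i) (s j) g y.
  rewrite eqxx (inj_eq s_inj) (gtn_eqF aj) addr0 => ->.
  by rewrite gH // addr0; apply: hop0; apply: gs; apply: ltnW.
have F1 y : hop (s j) (t i) (hop (t i) (s j) g) y = g y.
  have := hop_comm (s j) (t i) (t i) (s j) g y; rewrite !eqxx !hop_same.
  rewrite [X in _ = X + _]hop0; last by apply: gs.
  have [->|/gS[-> _ -> _]] := eqVneq (g y) 0; first by rewrite !mul0rn !addr0.
  rewrite ltnn subn0 (_ : n - j - i = (n - i - j.+1).+1)%N; last by lia.
  by rewrite mulrS add0r => /addIr.
move=> y; rewrite /swap_letters /= rev_cons -cats1 hops_cat.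
rewrite -/(swap_letters l) -gf; apply: eq_hops; exact: F1.
Qed.

Lemma unsweep f : (forall v : V, v + v = 0) -> stage 0 n f -> highest f ->
  let l := letters (stair_cells n) in hops (swap_letters l) (hops l f) =1 f.
Proof.
move=> V2 fS fH.
suff main k : (k <= n)%N -> let l := letters (stair_cells k) in
  highest (hops l f) /\ hops (swap_letters l) (hops l f) =1 f.
  by case: (main n (leqnn n)).
elim: k => [//|k IHk] kn /=; have [gH gf] := IHk (ltnW kn).
rewrite /letters map_cat -!/(letters _) swap_letters_cat !hops_cat.
have := row_unsweep V2 (leqnn _) (stage_sweep (ltnW kn) fS) gH.
rewrite subnn /= => -[rH _ _ rf]; split=> // y.
by rewrite (eq_hops _ rf) gf.
Qed.

End AnyTarget.

End Sweep.

(** * Rows and columns of a diagram *)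

Section Diagram.

Variables (N : nat) (sh : seq nat).
Hypothesis shN : sumn sh = N.

Local Notation row := (reshape_index sh).
Local Notation col := (reshape_offset sh).
Local Notation R := (row_stab N sh).
Local Notation C := (col_stab N sh).

Lemma row_stabP (p : 'S_N) : reflect (forall k, row (p k) = row k) (p \in R).
Proof. by rewrite inE; apply: (iffP forallP) => H k; apply/eqP. Qed.

Lemma col_stabP (p : 'S_N) : reflect (forall k, col (p k) = col k) (p \in C).
Proof. by rewrite inE; apply: (iffP forallP) => H k; apply/eqP. Qed.

Lemma row_stab_group : group_set R.
Proof.
apply/group_setP; split=> [|p q /row_stabP pR /row_stabP qR].
  by apply/row_stabP=> k; rewrite perm1.
by apply/row_stabP=> k; rewrite permM qR pR.
Qed.

Lemma col_stab_group : group_set C.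
Proof.
apply/group_setP; split=> [|p q /col_stabP pC /col_stabP qC].
  by apply/col_stabP=> k; rewrite perm1.
by apply/col_stabP=> k; rewrite permM qC pC.
Qed.

Lemma cell_inj (i j : 'I_N) : row i = row j -> col i = col j -> i = j.
Proof.
by move=> rij cij; apply: val_inj; rewrite /= -(reshape_indexK sh i) rij cij reshape_indexK.
Qed.

Lemma row_colI (p : 'S_N) : p \in R -> p \in C -> p = 1%g.
Proof.
move=> /row_stabP pR /col_stabP pC; apply/permP=> k; rewrite perm1.
exact: cell_inj.
Qed.

Lemma col_lt (i : 'I_N) : (col i < nth 0 sh (row i))%N.
Proof. by apply: reshape_offsetP; rewrite shN. Qed.

Lemma row_lt (i : 'I_N) : (row i < size sh)%N.
Proof. by apply: reshape_indexP; rewrite shN. Qed.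

Lemma cellP k j : (j < nth 0 sh k)%N -> exists i : 'I_N, row i = k /\ col i = j.
Proof.
move=> jk; have lt : (flatten_index sh k j < N)%N by rewrite -shN flatten_indexP.
by exists (Ordinal lt); rewrite /= flatten_indexKl // flatten_indexKr.
Qed.

(** The classical pigeonhole behind the Young symmetrizer: at most min(m, sh_k)
    cells of row k land in the first m columns, and these bounds add up to the
    exact number of cells there. So they are attained, and for m = sh_k this
    leaves all cells of row k within its length. *)
Lemma row_col_factor (g : 'S_N) :
    (forall i j : 'I_N, row i = row j -> col (g i) = col (g j) -> i = j) ->
  exists r c, [/\ r \in R, c \in C & g = (r * c)%g].
Proof.
move=> ginj.
have lt i : (col (g i) < nth 0 sh (row i))%N.
  pose A m (k : 'I_(size sh)) := #|[pred i : 'I_N | (row i == k) && (col (g i) < m)%N]|.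
  pose B m (k : 'I_(size sh)) := #|[pred i : 'I_N | (row i == k) && (col i < m)%N]|.
  have AB m k : (A m k <= B m k)%N.
    have [mk|km] := leqP m (nth 0 sh k).
      apply: (@leq_trans m).
        rewrite -[X in (_ <= X)%N](size_iota 0 m) /A cardE.
        rewrite -(size_map (fun i => col (g i))); apply: uniq_leq_size.
          rewrite map_inj_in_uniq ?enum_uniq // => i1 i2; rewrite !mem_enum !inE.
          by move=> /andP[/eqP r1 _] /andP[/eqP r2 _]; apply: ginj; rewrite r1.
        move=> _ /mapP[i1 Ai1 ->]; rewrite mem_iota leq0n add0n.
        by move: Ai1; rewrite mem_enum inE => /andP[].
      rewrite -[X in (X <= _)%N](size_iota 0 m) /B cardE -(size_map (fun i : 'I_N => col i)).
      apply: uniq_leq_size => [|j]; rewrite ?iota_uniq // mem_iota /= => jm.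
      have [i1 [r1 c1]] := cellP (leq_trans jm mk).
      by apply/mapP; exists i1; rewrite // mem_enum inE r1 c1 eqxx.
    apply/subset_leq_card/subsetP=> i1; rewrite !inE => /andP[/eqP r1 _].
    by rewrite r1 eqxx (leq_ltn_trans _ km) // ltnW // -r1 col_lt.
  have tot m (f : 'I_N -> nat) :
      \sum_(k < size sh) #|[pred i : 'I_N | (row i == k) && (f i < m)%N]|
        = #|[pred i | (f i < m)%N]|.
    rewrite -sum1_card (partition_big (fun i => Ordinal (row_lt i)) predT) //=.
    apply: eq_bigr => k _; rewrite -sum1_card; apply: eq_bigl => i1.
    by rewrite !inE andbC.
  pose m := nth 0 sh (row i).
  have [_] := leqif_sum (fun k (_ : xpredT k) => leqif_eq (AB m k)).
  rewrite !tot -!sum1_card [X in X == _](reindex_inj (@perm_inj _ g^-1%g)) /=.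
  rewrite (eq_bigl (fun i : 'I_N => (col i < m)%N)) => [|j]; last by rewrite inE permKV.
  rewrite eqxx => /esym/forallP/(_ (Ordinal (row_lt i)))/= /eqP eqAB.
  have sub : [pred j : 'I_N | (row j == row i) && (col (g j) < m)%N]
               \subset [pred j : 'I_N | row j == row i].
    by apply/subsetP=> j; rewrite !inE => /andP[].
  suff cAB : #|[pred j : 'I_N | (row j == row i) && (col (g j) < m)%N]| =
             #|[pred j : 'I_N | row j == row i]|.
    by have /(subset_cardP cAB)/(_ i) := sub; rewrite !inE eqxx.
  rewrite -[LHS]/(A m (Ordinal (row_lt i))) eqAB; apply: eq_card => j; rewrite !inE /=.
  by case: eqP => // ri; rewrite /m -ri col_lt.
have ltf (i : 'I_N) : (flatten_index sh (row i) (col (g i)) < N)%N.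
  by have := flatten_indexP (lt i); rewrite shN.
pose f i := Ordinal (ltf i).
have fv i : f i = flatten_index sh (row i) (col (g i)) :> nat by [].
have frow i : row (f i) = row i by rewrite fv flatten_indexKl.
have fcol i : col (f i) = col (g i) by rewrite fv flatten_indexKr.
have finj : injective f.
  move=> i j fij; apply: ginj; first by rewrite -(frow i) -(frow j) fij.
  by rewrite -(fcol i) -(fcol j) fij.
pose r := perm finj; exists r, (r^-1 * g)%g; split; last by rewrite mulKVg.
  by apply/row_stabP=> k; rewrite permE.
by apply/col_stabP=> k; rewrite permM -{2}(permKV r k) [in RHS]permE fcol.
Qed.

End Diagram.

(** * The Young symmetrizer *)

Section Convolution.

Variables (K : comNzRingType) (gT : finGroupType).
Implicit Types (phi psi : gT -> K).

(** The product of the group algebra, in terms of coefficients. *)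
Definition conv phi psi (g : gT) : K := \sum_x phi x * psi (x^-1 * g)%g.

Lemma convC1 phi psi g : conv phi psi g = \sum_x phi (g * x^-1)%g * psi x.
Proof.
rewrite /conv (reindex_inj (inj_comp (mulgI g) (@invg_inj _))) /=.
by apply: eq_bigr => x _; rewrite invMg invgK mulgKV.
Qed.

End Convolution.

Section YoungCoef.

Variables (N : nat) (sh : seq nat) (K : comNzRingType).

Definition ycoef (g : 'S_N) : K :=
  \sum_(p in setX (row_stab N sh) (col_stab N sh) | (p.1 * p.2)%g == g)
     (-1) ^+ odd_perm p.2.

Hypothesis shN : sumn sh = N.

Local Notation R := (row_stab N sh).
Local Notation C := (col_stab N sh).

Let RG := Group (row_stab_group N sh).
Let CG := Group (col_stab_group N sh).

Lemma ycoef_factor r c : r \in R -> c \in C ->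
  ycoef (r * c)%g = (-1) ^+ odd_perm c.
Proof.
move=> Rr Cc; rewrite /ycoef (big_pred1 (r, c)) // => -[r' c'] /=.
rewrite in_setX /= xpair_eqE; apply/andP/andP=> [[/andP[Rr' Cc'] /eqP e]|[]].
  have e1 : (r^-1 * r' = c * c'^-1)%g by rewrite -(mulgK c' r') e -!mulgA mulKg.
  have rr' : (r^-1 * r')%g = 1%g.
    apply: (@row_colI N sh); first by rewrite (groupM (G := RG)) ?(groupV RG).
    by rewrite e1 (groupM (G := CG)) ?(groupV CG).
  split; first by rewrite eq_sym eq_mulVg1 rr'.
  by rewrite eq_sym eq_mulgV1 -e1 rr'.
by move=> /eqP-> /eqP->; rewrite Rr Cc.
Qed.

Lemma ycoef1 : ycoef 1 = 1.
Proof.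
by rewrite -[1%g]mulg1 ycoef_factor ?(group1 RG) ?(group1 CG) // odd_perm1.
Qed.

Lemma ycoef_row r g : r \in R -> ycoef (r * g)%g = ycoef g.
Proof.
move=> Rr; rewrite /ycoef [LHS](reindex_inj (h := fun p => (r * p.1, p.2)%g)) /=.
  apply: eq_bigl => -[a b]; rewrite !in_setX /= (groupMl (G := RG)) //.
  by rewrite -mulgA (inj_eq (mulgI _)).
by move=> [a b] [a' b'] [/mulgI-> ->].
Qed.

Lemma ycoef_col c g : c \in C -> ycoef (g * c)%g = (-1) ^+ odd_perm c * ycoef g.
Proof.
move=> Cc; rewrite /ycoef (reindex_inj (h := fun p => (p.1, p.2 * c)%g)) /=.
  rewrite big_distrr /=; apply: eq_big => -[a b].
    rewrite !in_setX /= (groupMr (G := CG)) //.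
    by rewrite mulgA (inj_eq (mulIg _)).
  by move=> _; rewrite odd_permM signr_addb mulrC.
by move=> [a b] [a' b'] [-> /mulIg->].
Qed.

(** If g is not a product of a row and a column permutation, then g^-1 t g is in
    the column group for some transposition t of the row group, and so
    phi g = phi (t g) = - phi g. *)
Lemma ycoef_unique (phi : 'S_N -> K) : (forall x : K, x + x = 0 -> x = 0) ->
    (forall r g, r \in R -> phi (r * g)%g = phi g) ->
    (forall c g, c \in C -> phi (g * c)%g = (-1) ^+ odd_perm c * phi g) ->
  forall g, phi g = phi 1%g * ycoef g.
Proof.
move=> K2 phiR phiC g.
have [/existsP[i /existsP[j /and3P[ij /eqP rij /eqP cij]]]|nij] :=
  boolP [exists i : 'I_N, exists j : 'I_N, [&& i != j,
    reshape_index sh i == reshape_index sh j &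
    reshape_offset sh (g i) == reshape_offset sh (g j)]].
  suff zero (psi : 'S_N -> K) : (forall r g, r \in R -> psi (r * g)%g = psi g) ->
    (forall c g, c \in C -> psi (g * c)%g = (-1) ^+ odd_perm c * psi g) -> psi g = 0.
    rewrite zero // (zero ycoef) ?mulr0 //; [exact: ycoef_row | exact: ycoef_col].
  move=> psiR psiC; apply: K2.
  have tR : tperm i j \in R by apply/row_stabP=> k; case: tpermP => [->|->|].
  have tC : tperm (g i) (g j) \in C by apply/col_stabP=> k; case: tpermP => [->|->|].
  have tg : (tperm i j * g = g * tperm (g i) (g j))%g.
    by rewrite -tpermJ conjgE !mulgA mulgV mul1g.
  rewrite -{1}(psiR _ g tR) tg psiC // odd_tperm (inj_eq perm_inj) ij.
  by rewrite expr1 mulN1r addNr.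
have [i j rij cij|r [c [Rr Cc ->]]] := row_col_factor shN (g := g).
  apply/eqP; apply: contraNT nij => ij; apply/existsP; exists i; apply/existsP.
  by exists j; rewrite ij rij cij !eqxx.
by rewrite ycoef_factor // phiC // -[r]mulg1 phiR // mulrC.
Qed.

Definition yscalar : K := conv ycoef ycoef 1%g.

Lemma conv_ycoef : (forall x : K, x + x = 0 -> x = 0) ->
  conv ycoef ycoef =1 (fun g => yscalar * ycoef g).
Proof.
move=> K2 g; apply: (ycoef_unique K2) => [r x Rr|c x Cc].
  rewrite {1}/conv (reindex_inj (mulgI r)) /=; apply: eq_bigr => y _.
  by rewrite ycoef_row // invMg mulgA mulgKV.
rewrite /conv big_distrr /=; apply: eq_bigr => y _.
by rewrite mulgA ycoef_col // mulrCA.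
Qed.

(** The Young symmetrizer cuts the group algebra down to a line; the scalar is
    found by comparing coefficients at 1. *)
Lemma conv_ycoef_sandwich (phi : 'S_N -> K) : (forall x : K, x + x = 0 -> x = 0) ->
  conv ycoef (conv phi ycoef) =1
    (fun g => yscalar * (\sum_x phi x * ycoef x^-1%g) * ycoef g).
Proof.
move=> K2 g; rewrite (ycoef_unique (phi := conv ycoef (conv phi ycoef)) K2).
- congr (_ * _); rewrite convC1.
  rewrite (eq_bigr (fun x => \sum_y phi y * (ycoef x^-1%g * ycoef (y^-1 * x)%g))).
    rewrite exchange_big big_distrr /=; apply: eq_bigr => y _.
    rewrite -big_distrr /= mulrCA; congr (_ * _).
    rewrite -conv_ycoef // [RHS](reindex_inj (mulgI y^-1%g)) /=.
    by apply: eq_bigr => x _; rewrite invMg invgK mulgK mulrC.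
  move=> x _; rewrite mul1g /conv big_distrr /=; apply: eq_bigr => y _.
  by rewrite mulrCA.
- move=> r x Rr; rewrite {1}/conv (reindex_inj (mulgI r)) /=; apply: eq_bigr => y _.
  by rewrite ycoef_row // invMg mulgA mulgKV.
move=> c x Cc; rewrite /conv big_distrr /=; apply: eq_bigr => y _.
rewrite mulrCA; congr (_ * _); rewrite big_distrr /=; apply: eq_bigr => z _.
by rewrite !mulgA ycoef_col // mulrCA.
Qed.

End YoungCoef.

(** * Specht modules inside the regular representation *)

Section QuasiIdempotents.

Variables (F : fieldType) (n : nat).

Lemma quasi_idem_factor (h : F) (P U : 'M[F]_n) :
    (U :=: P)%MS -> P *m P = h *: P ->
  exists2 Q, P = Q *m row_base U & row_base U *m Q = h%:M.
Proof.
move=> UP P2; have BU : (row_base U :=: U)%MS by apply: eq_row_base.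
have [Q PQ] : exists Q, P = Q *m row_base U by apply/submxP; rewrite BU UP.
have [D BD] : exists D, row_base U = D *m P by apply/submxP; rewrite BU UP.
exists Q => //; apply: (row_free_inj (row_base_free U)).
by rewrite -mulmxA -PQ mul_scalar_mx {1}BD -mulmxA P2 -scalemxAr -BD.
Qed.

Lemma mxtrace_quasi_idem (h : F) (P : 'M[F]_n) :
  P *m P = h *: P -> \tr P = h * (\rank P)%:R.
Proof.
move=> P2; have [//|Q PQ BQ] := @quasi_idem_factor h P P _ P2.
by rewrite {1}PQ mxtrace_mulC BQ mxtrace_scalar mulr_natr.
Qed.

(** P acts as h times a projection onto U, so the trace of an operator on U can
    be computed on the whole module, after composition with P. *)
Lemma trace_submod (gT : finGroupType) (G : {group gT})
    (rG : mx_representation F G n) (h : F) (P U : 'M[F]_n)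
    (modU : mxmodule rG U) x :
    (U :=: P)%MS -> P *m P = h *: P -> x \in G ->
  h * \tr (submod_repr modU x) = \tr (rG x *m P).
Proof.
move=> UP P2 Gx; have [Q PQ BQ] := quasi_idem_factor UP P2.
have Bx : row_base U *m rG x = submod_repr modU x *m row_base U.
  have := val_submodJ modU 1%:M Gx.
  by rewrite mul1mx /val_submod /= mul1mx.
have -> : \tr (rG x *m P) = \tr (row_base U *m rG x *m Q).
  by rewrite {1}PQ mulmxA mxtrace_mulC mulmxA.
by rewrite Bx -mulmxA BQ mul_mx_scalar mxtraceZ.
Qed.

End QuasiIdempotents.

Section GroupAlgebra.

Variables (F : fieldType) (N : nat).

Local Notation G := (symgroup N).
Local Notation aG := (regular_repr F G).

Definition opf n (rG : mx_representation F G n) (phi : 'S_N -> F) : 'M[F]_n :=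
  \sum_g phi g *: rG g.

Lemma opf_mul n (rG : mx_representation F G n) phi psi :
  opf rG phi *m opf rG psi = opf rG (conv phi psi).
Proof.
rewrite /opf mulmx_suml [RHS](eq_bigr (fun g => \sum_x (phi x * psi (x^-1 * g)%g) *: rG g)).
  rewrite exchange_big; apply: eq_bigr => x _; rewrite mulmx_sumr.
  rewrite [RHS](reindex_inj (mulgI x)) /=; apply: eq_bigr => g _.
  by rewrite mulKg -scalemxAl -scalemxAr scalerA repr_mxM ?inE.
by move=> g _; rewrite -scaler_suml.
Qed.

Lemma symmetrizer_opf n (rG : mx_representation F G n) sh :
  (\sum_(r in row_stab N sh) rG r)
    *m (\sum_(c in col_stab N sh) (-1) ^+ odd_perm c *: rG c) =
  opf rG (ycoef sh F).
Proof.
rewrite mulmx_suml /opf /ycoef.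
under [RHS]eq_bigr => g _ do rewrite scaler_suml.
rewrite (exchange_big_dep predT) //=.
under eq_bigr => r _ do rewrite mulmx_sumr.
rewrite pair_big_dep /=.
rewrite (eq_bigl (fun p => p \in setX (row_stab N sh) (col_stab N sh))); last first.
  by move=> [r c]; rewrite in_setX.
rewrite big_mkcond [RHS]big_mkcond; apply: eq_bigr => -[r c] _ /=.
case: ifP => rc; last by rewrite big_pred0 // => g; rewrite ?rc.
rewrite (big_pred1 (r * c)%g) => [|g]; last by rewrite /= ?rc /= eq_sym.
by rewrite -scalemxAr repr_mxM ?inE.
Qed.

(** Left multiplication by an element of the group algebra, as a matrix acting
    on the right of the rows of the regular representation. *)
Definition lmulg (phi : 'S_N -> F) : 'M[F]_#|G| :=
  \matrix_(i, j) phi (enum_val j * (enum_val i)^-1)%g.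

Lemma sum_enum_val (f : 'S_N -> F) : \sum_(i < #|G|) f (enum_val i) = \sum_g f g.
Proof. by rewrite -(big_enum_val f) /=; apply: eq_bigl => g; rewrite inE. Qed.

Lemma regular_reprE x i j :
  aG x i j = ((enum_val i * x)%g == enum_val j)%:R.
Proof.
rewrite mxE /= mxE eqxx /= -[j in j == _](gring_valK j) (can_in_eq (@gring_indexK _ G)) ?inE //.
by rewrite eq_sym.
Qed.

Lemma lmulg_mul phi psi : lmulg phi *m lmulg psi = lmulg (conv psi phi).
Proof.
apply/matrixP=> i j; rewrite !mxE.
pose f g := phi (g * (enum_val i)^-1)%g * psi (enum_val j * g^-1)%g.
rewrite (eq_bigr (fun k => f (enum_val k))).
  rewrite sum_enum_val /f convC1 (reindex_inj (mulIg (enum_val i))) /=.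
  by apply: eq_bigr => g _; rewrite mulgK invMg mulgA mulrC.
by move=> k _; rewrite !mxE.
Qed.

Lemma regular_lmulgE x phi i j :
  (aG x *m lmulg phi) i j = phi (enum_val j * x^-1 * (enum_val i)^-1)%g.
Proof.
pose f g := ((enum_val i * x)%g == g)%:R * phi (enum_val j * g^-1)%g.
rewrite mxE (eq_bigr (fun k => f (enum_val k))) => [|k _].
  rewrite sum_enum_val /f (bigD1 (enum_val i * x)%g) //= eqxx mul1r.
  rewrite big1 ?addr0 => [|g gi]; last by rewrite eq_sym (negPf gi) mul0r.
  by rewrite invMg mulgA.
by rewrite regular_reprE mxE.
Qed.

Lemma lmulg_regularE x phi i j :
  (lmulg phi *m aG x) i j = phi (enum_val j * x^-1 * (enum_val i)^-1)%g.
Proof.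
pose f g := phi (g * (enum_val i)^-1)%g * ((g * x)%g == enum_val j)%:R.
rewrite mxE (eq_bigr (fun k => f (enum_val k))) => [|k _].
  rewrite sum_enum_val /f (bigD1 (enum_val j * x^-1)%g) //=.
  rewrite mulgKV eqxx mulr1 big1 ?addr0 // => g gi.
  by rewrite (can2_eq (mulgK x) (mulgKV x)) (negPf gi) mulr0.
by rewrite regular_reprE mxE.
Qed.

Lemma lmulg_comm x phi : aG x *m lmulg phi = lmulg phi *m aG x.
Proof. by apply/matrixP=> i j; rewrite regular_lmulgE lmulg_regularE. Qed.

Lemma mxtrace_regular_lmulg x phi :
  \tr (aG x *m lmulg phi) = \sum_g phi (g * x^-1 * g^-1)%g.
Proof.
rewrite -(sum_enum_val (fun g => phi (g * x^-1 * g^-1)%g)).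
by apply: eq_bigr => i _; rewrite regular_lmulgE.
Qed.

Lemma row_lmulg phi i :
  row i (lmulg phi) = gring_row (opf aG phi) *m aG (enum_val i).
Proof.
rewrite -gring_row_mul /opf mulmx_suml linear_sum; apply/rowP=> j.
rewrite mxE mxE summxE (bigD1 (enum_val j * (enum_val i)^-1)%g) //=.
rewrite big1 ?addr0 => [|g gi]; rewrite -scalemxAl -repr_mxM ?inE // linearZ mxE;
  rewrite /gring_row mxE regular_reprE gring_indexK ?inE // mul1g.
  by rewrite mulgKV eqxx mulr1.
by rewrite (can2_eq (mulgK _) (mulgKV _)) (negPf gi) mulr0.
Qed.

End GroupAlgebra.

Section SpechtModule.

Variables (F : fieldType) (N : nat) (sh : seq nat).
Hypothesis charF0 : [pchar F] =i pred0.
Hypothesis shN : sumn sh = N.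

Local Notation G := (symgroup N).
Local Notation aG := (regular_repr F G).
Local Notation e := (@ycoef N sh F).
Local Notation h := (yscalar N sh F).
Local Notation S := (specht_mx F N sh).

Lemma pchar0_natr (m : nat) : (m%:R == 0 :> F) = (m == 0%N).
Proof. by have /pcharf0P := charF0; apply. Qed.

Lemma pchar0_mulrn (V : lmodType F) (v : V) k : (0 < k)%N -> v *+ k = 0 -> v = 0.
Proof.
move=> k_gt0 /eqP; rewrite -scaler_nat scaler_eq0 pchar0_natr.
by case/orP=> /eqP // k0; rewrite k0 in k_gt0.
Qed.

Lemma pchar0_double (x : F) : x + x = 0 -> x = 0.
Proof. by move=> x2; apply: (@pchar0_mulrn F^o x 2); rewrite // mulr2n. Qed.

Lemma specht_mxE : (S :=: lmulg e)%MS.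
Proof.
apply/eqmxP; rewrite /specht_mx.
have rowE g : row (gring_index G g) (lmulg e) = gring_row (young_symmetrizer F N sh) *m aG g.
  by rewrite row_lmulg gring_indexK ?inE // -symmetrizer_opf.
apply/andP; split.
  apply: cyclic_mx_sub.
    apply/mxmoduleP=> x Gx; rewrite -lmulg_comm; exact: submxMl.
  by rewrite -[gring_row _]mulmx1 -(repr_mx1 aG) -rowE row_sub.
apply/row_subP=> i; rewrite -(gring_valK i) rowE.
apply/cyclic_mxP; exists (aG (enum_val i)) => //.
by apply: envelop_mx_id; rewrite inE.
Qed.

Lemma lmulg_ycoef2 : lmulg e *m lmulg e = h *: lmulg e.
Proof.
rewrite lmulg_mul; apply/matrixP=> i j; rewrite !mxE conv_ycoef //.
exact: pchar0_double.
Qed.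

(** Left multiplication by e projects the group algebra onto the Specht module,
    up to the factor h, and commutes with right translations. *)
Lemma specht_trace x :
  h * \tr (specht F N sh x) = \sum_g e (g * x^-1 * g^-1)%g.
Proof.
rewrite -mxtrace_regular_lmulg; apply: trace_submod; rewrite ?inE //.
  exact: specht_mxE.
exact: lmulg_ycoef2.
Qed.

Lemma specht_dim : h * (\rank S)%:R = #|'S_N|%:R.
Proof.
have := specht_trace 1%g; rewrite repr_mx1 mxtrace1 => ->.
rewrite (eq_bigr (fun=> 1)) => [|g _]; first by rewrite sumr_const.
by rewrite invg1 mulg1 mulgV ycoef1.
Qed.

Lemma yscalar_neq0 : h != 0.
Proof.
have : #|'S_N|%:R != 0 :> F.
  by rewrite pchar0_natr -lt0n; apply/card_gt0P; exists 1%g.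
by rewrite -specht_dim mulf_eq0 negb_or => /andP[].
Qed.

Lemma specht_dim_gt0 : (0 < \rank S)%N.
Proof.
rewrite lt0n; apply/eqP=> S0; have := specht_dim; rewrite S0 mulr0 => /esym/eqP.
by rewrite pchar0_natr => /eqP/(@card0_eq _ _)/(_ 1%g).
Qed.

Lemma opf_ycoef2 n (rU : mx_representation F G n) :
  opf rU e *m opf rU e = h *: opf rU e.
Proof.
rewrite opf_mul /opf scaler_sumr; apply: eq_bigr => g _.
by rewrite scalerA conv_ycoef //; apply: pchar0_double.
Qed.

Lemma specht_opf_neq0 : opf (specht F N sh) e != 0.
Proof.
pose i := gring_index G 1%g.
have li : row i (lmulg e) = gring_row (opf aG e).
  by rewrite row_lmulg gring_indexK ?group1 // repr_mx1 mulmx1.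
have val A : val_submod (A *m opf (specht F N sh) e) = val_submod A *m opf aG e.
  rewrite /opf !mulmx_sumr linear_sum; apply: eq_bigr => g _.
  by rewrite -!scalemxAr linearZ /= val_submodJ ?inE.
have : row i (lmulg e) *m opf aG e != 0.
  rewrite li -gring_row_mul opf_ycoef2 linearZ scaler_eq0 (negPf yscalar_neq0) /= -li.
  apply/eqP=> /rowP/(_ i); rewrite !mxE mulgV ycoef1 => /eqP.
  by rewrite oner_eq0.
apply: contraNneq => e0; have Si : (row i (lmulg e) <= S)%MS by rewrite specht_mxE row_sub.
by rewrite -(in_submodK Si) -val e0 mulmx0 linear0.
Qed.

(** Let u be a vector such that u e has a nonzero coordinate j. Then e y |-> u e y
    maps the Specht module into the representation. The j-th matrix coefficients
    map the representation back into the group algebra; followed by left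
    multiplication by e, this gives a multiple of the identity on the Specht
    module, by conv_ycoef_sandwich, and the factor is h times that coordinate. *)
Lemma specht_subrepr n (rU : mx_representation F G n) :
  opf rU e != 0 -> is_subrepr (specht F N sh) rU.
Proof.
case/matrix0Pn=> i [j nz].
pose Phi : 'M[F]_(#|G|, n) := \matrix_(k < #|G|) row i (rU (enum_val k)).
pose Psi : 'M[F]_(n, #|G|) := \matrix_(l, k) rU (enum_val k)^-1%g l j.
pose theta g := rU g^-1%g i j.
have PhiPsi : Phi *m Psi = lmulg theta.
  apply/matrixP=> k l; rewrite !mxE /theta invMg invgK repr_mxM ?inE // mxE.
  by apply: eq_bigr => m _; rewrite !mxE.
pose c := h * \sum_x theta x * e x^-1%g.
have c_neq0 : c != 0.
  rewrite mulf_neq0 ?yscalar_neq0 //; apply: contraNneq nz => c0.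
  rewrite summxE -[X in _ == X]c0 (reindex_inj invg_inj) /=; apply/eqP/eq_bigr => g _.
  by rewrite mxE mulrC.
have sandwich : lmulg e *m (Phi *m Psi) *m lmulg e = c *: lmulg e.
  rewrite PhiPsi !lmulg_mul; apply/matrixP=> k l; rewrite !mxE.
  by rewrite conv_ycoef_sandwich //; apply: pchar0_double.
pose B := row_base S *m Phi.
have Phix x : aG x *m Phi = Phi *m rU x.
  apply/row_matrixP=> k; rewrite !row_mul rowK [row k _]rowK -rowE rowK.
  by rewrite gring_indexK ?inE // repr_mxM ?inE // row_mul.
have baseL : (row_base S <= lmulg e)%MS by rewrite eq_row_base specht_mxE.
have Bfree : row_free B.
  have [D DL] := submxP baseL.
  have BL : B *m (Psi *m lmulg e) = c *: row_base S.
    rewrite /B {1}DL DL scalemxAr -sandwich.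
    by rewrite !mulmxA.
  have /row_freeP[E BE] := row_base_free S.
  apply/row_freeP; exists (c^-1 *: ((Psi *m lmulg e) *m E)).
  by rewrite -scalemxAr mulmxA BL -scalemxAl BE scalerA mulVf // scale1r.
have Bx x : specht F N sh x *m B = B *m rU x.
  rewrite /B -[RHS]mulmxA -Phix !mulmxA; congr (_ *m Phi).
  have := val_submodJ (cyclic_mx_module aG (gring_row (young_symmetrizer F N sh))) 1%:M (in_setT x).
  by rewrite mul1mx /val_submod /= mul1mx => <-; rewrite -mulmxA.
have modB : mxmodule rU <<B>>%MS.
  apply/mxmoduleP=> x _; rewrite (eqmxMr _ (genmxE _)) genmxE -Bx; exact: submxMl.
exists <<B>>%MS, modB.
have BsB : (B <= <<B>>)%MS by rewrite genmxE.
apply: (MxReprSim (B := in_submod <<B>>%MS B)).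
- by rewrite genmxE; apply/esym/eqP.
- by rewrite /row_free mxrank_in_submod.
move=> x Gx; rewrite -in_submodJ // -Bx.
by rewrite [RHS]in_submodE [in LHS]in_submodE mulmxA.
Qed.

End SpechtModule.

Section Pairing.

Variables (F : fieldType) (N : nat).
Hypothesis charF0 : [pchar F] =i pred0.

Local Notation G := (symgroup N).

Section OneShape.

Variable sh : seq nat.
Hypothesis shN : sumn sh = N.

Local Notation e := (@ycoef N sh F).
Local Notation h := (yscalar N sh F).

Lemma opf_ycoef_trace n (rU : mx_representation F G n) :
  (\tr (opf rU e) != 0) = (opf rU e != 0).
Proof.
have e2 := opf_ycoef2 charF0 shN rU.
rewrite (mxtrace_quasi_idem e2) mulf_eq0 (negPf (yscalar_neq0 charF0 shN)) /=.
by rewrite (pchar0_natr charF0) mxrank_eq0.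
Qed.

Definition kappa (x : 'S_N) : F := \sum_g e (g * x^-1 * g^-1)%g.

Lemma kappa_char x : kappa x = h * \tr (specht F N sh x).
Proof. by rewrite specht_trace. Qed.

(** The inverse of r c is conjugate to r^-1 c^-1, a product of the same kind. *)
Lemma kappa_inv x : kappa x^-1%g = kappa x.
Proof.
have kappaE y : kappa y = \sum_(p in setX (row_stab N sh) (col_stab N sh))
   (-1) ^+ odd_perm p.2 *+ #|[pred g | (p.1 * p.2)%g == (g * y^-1 * g^-1)%g]|.
  rewrite /kappa /ycoef (exchange_big_dep (mem (setX (row_stab N sh) (col_stab N sh)))) //=.
    by apply: eq_bigr => p pRC; rewrite -sumr_const; apply: eq_bigl => g; rewrite pRC.
  by move=> g p _ /andP[].
pose RG := Group (row_stab_group N sh); pose CG := Group (col_stab_group N sh).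
rewrite !kappaE (reindex_inj (h := fun p : 'S_N * 'S_N => (p.1^-1, p.2^-1)%g)) /=.
  apply: eq_big => [[r c]|[r c] _]; first by rewrite !in_setX /= (groupV RG) (groupV CG).
  rewrite odd_permV; congr (_ *+ _).
  rewrite -!sum1_card (reindex_inj (mulgI r^-1%g)) /=; apply: eq_bigl => g.
  rewrite !inE !invMg !invgK -!mulgA (inj_eq (mulgI _)).
  by rewrite -(inj_eq (mulIg r^-1%g)) -[RHS](inj_eq (@invg_inj _)) !invMg !invgK !mulgA mulgK.
by move=> [a b] [a' b'] [/invg_inj-> /invg_inj->].
Qed.

Lemma specht_char_inv x : \tr (specht F N sh x^-1%g) = \tr (specht F N sh x).
Proof.
by apply: (mulfI (yscalar_neq0 charF0 shN)); rewrite -!kappa_char kappa_inv.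
Qed.

Lemma repr_trace_conj n (rU : mx_representation F G n) x g :
  \tr (rU (g * x * g^-1)%g) = \tr (rU x).
Proof.
by rewrite !repr_mxM ?inE // mxtrace_mulC mulmxA -repr_mxM ?inE // mulVg repr_mx1 mul1mx.
Qed.

(** The character being a class function, the coefficients of the symmetrizer can
    be averaged over conjugation, which turns them into the Specht character. *)
Lemma opf_ycoef_pairing n (rU : mx_representation F G n) :
  #|'S_N|%:R * \tr (opf rU e) =
  h * \sum_x \tr (specht F N sh x^-1%g) * \tr (rU x).
Proof.
have trE : \tr (opf rU e) = \sum_x e x * \tr (rU x).
  by rewrite /opf linear_sum; apply: eq_bigr => x _; rewrite linearZ.
rewrite mulr_natl trE big_distrr /= -sumr_const.
under [RHS]eq_bigr => x _ do rewrite mulrA -kappa_char /kappa big_distrl /=.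
rewrite [RHS]exchange_big; apply: eq_bigr => g _.
rewrite (reindex_inj (conjg_inj g^-1%g)) /=; apply: eq_bigr => x _.
by rewrite conjgE !invgK !mulgA repr_trace_conj.
Qed.

End OneShape.

End Pairing.

(** * Words of length a power of two *)

Section Words.

Variable gT : finGroupType.
Implicit Types (w : gT -> int) (K : pred gT).

Definition wprod (s : seq gT) : gT := (\prod_(x <- s) x)%g.

(** The sum of the coefficients, over K, of the l-th power of w in the group
    algebra, before collecting terms. *)
Definition wsum (l : nat) w K : int :=
  \sum_(t : l.-tuple gT | K (wprod t)) \prod_(x <- t) w x.

Lemma wprod_cat s1 s2 : wprod (s1 ++ s2) = (wprod s1 * wprod s2)%g.
Proof. exact: big_cat. Qed.

Lemma wsumS l w K :
  wsum l.+1 w K = \sum_x w x * wsum l w (fun g => K (x * g)%g).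
Proof.
rewrite /wsum (eq_bigr (fun x => \sum_(t : l.-tuple gT | K (x * wprod t)%g)
                                   w x * \prod_(y <- t) w y)); last first.
  by move=> x _; rewrite big_distrr.
rewrite pair_big_dep /=.
rewrite (reindex (fun p : gT * l.-tuple gT => cons_tuple p.1 p.2)) /=.
  by apply: eq_big => [[x t]|[x t] _]; rewrite /= ?/wprod big_cons.
exists (fun t : l.+1.-tuple gT => (thead t, behead_tuple t)) => [[x t] _|t _].
  by congr (_, _); apply: val_inj.
by apply: val_inj; rewrite /= [in RHS](tuple_eta t).
Qed.

Lemma wsum_power (e : gT -> int) (h : int) l K :
    conv e e =1 (fun g => h * e g) ->
  wsum l.+1 e K = h ^+ l * \sum_(g | K g) e g.
Proof.
move=> ee; elim: l K => [|l IHl] K; rewrite wsumS.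
  rewrite mul1r [RHS]big_mkcond; apply: eq_bigr => x _.
  rewrite /wsum (eq_bigl (fun t => (t == [tuple]) && K x)) => [|t]; last first.
    by rewrite tuple0 eqxx /wprod big_nil mulg1.
  rewrite big_mkcondr big_pred1_eq big_nil.
  by case: ifP; rewrite ?mulr1 ?mulr0.
under eq_bigr => x _ do rewrite IHl mulrCA.
rewrite -big_distrr exprSr -mulrA; congr (_ * _) => /=.
under eq_bigr => x _ do rewrite big_distrr (reindex_inj (mulgI x^-1%g)) /=.
under eq_bigr => x _ do under eq_bigl => g do rewrite mulKVg.
rewrite exchange_big big_distrr /=; apply: eq_bigr => g _.
by rewrite -ee.
Qed.

Section Rotation.

Variable l : nat.
Local Notation T := ((l + l).-tuple gT).

Definition rot1 (t : T) : T := [tuple of seq.rot 1%N t].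

Lemma rot1_inj : injective rot1.
Proof. by move=> t u /(congr1 val)/seq.rot_inj/val_inj. Qed.

Definition rotation : {perm T} := perm rot1_inj.

Lemma iter_rotation k (t : T) :
  (k <= l + l)%N -> val (iter k rotation t) = seq.rot k t.
Proof.
elim: k => [|k IHk] kl; first by rewrite rot0.
by rewrite iterS permE /= IHk ?(ltnW kl) // -rotS ?size_tuple.
Qed.

Lemma wprod_rot1 (t : T) : exists g, wprod (rot1 t) = (wprod t ^ g)%g.
Proof.
rewrite /= /seq.rot; exists (wprod (take 1%N t)).
by rewrite wprod_cat -{3}(cat_take_drop 1 t) wprod_cat conjgE mulgA mulKg.
Qed.

Lemma prod_rot1 w (t : T) : \prod_(x <- rot1 t) w x = \prod_(x <- t) w x.
Proof. by apply: perm_big; rewrite perm_rot. Qed.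

Lemma card_porbit_rotation m (t : T) :
  l = (2 ^ m)%N -> seq.rot l t != t -> #|porbit rotation t| = (l + l)%N.
Proof.
move=> lm tl; have ll : (l + l = 2 ^ m.+1)%N by rewrite lm addnn expnS mul2n.
have rot_l : (rotation ^+ (l + l) = 1)%g.
  apply/permP=> u; rewrite permX perm1; apply: val_inj.
  by rewrite iter_rotation // -{1}(size_tuple u) rot_size.
have : (#|porbit rotation t| %| 2 ^ m.+1)%N.
  have -> : porbit rotation t = orbit 'P%act <[rotation]>%g t.
    by rewrite porbit.unlock.
  apply: dvdn_trans (dvdn_orbit _ _ _) _.
  by rewrite -orderE order_dvdn -ll rot_l.
case/(dvdn_pfactor _ _ (isT : prime 2)) => k; rewrite leq_eqVlt ltnS.
case/predU1P => [-> ->//|km kt]; case/eqP: tl.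
have per a : iter (a * 2 ^ k) rotation t = t.
  elim: a => // a IHa; rewrite mulSn iterD IHa.
  by move: (iter_porbit rotation t); rewrite kt.
have := per (2 ^ (m - k))%N; rewrite -expnD subnK // -lm => itt.
by rewrite -iter_rotation ?leq_addr // itt.
Qed.

(** Words that are not the square of a shorter word fall into rotation orbits
    of full length, since their stabilisers in a cyclic 2-group are trivial;
    rotating a word conjugates its product. The squares u u give the second
    term. *)
Lemma wsum_double m w K : l = (2 ^ m)%N ->
    (forall x g, K (x ^ g)%g = K x) ->
  (((l + l)%:Z %| wsum (l + l) w K -
      wsum l (fun x => w x ^+ 2) (fun x => K (x ^+ 2)%g))%Z).
Proof.
move=> lm KJ; rewrite {1}/wsum (bigID (fun t : T => seq.rot l t == t)) /=.
have -> : \sum_(t : T | K (wprod t) && (seq.rot l t == t)) \prod_(x <- t) w x =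
    wsum l (fun x => w x ^+ 2) (fun x => K (x ^+ 2)%g).
  rewrite (reindex (fun u : l.-tuple gT => [tuple of u ++ u])) /=.
    apply: eq_big => [u|u _].
      have rotu : seq.rot l (u ++ u) = u ++ u.
        by rewrite -[RHS]rot_size_cat size_tuple.
      by rewrite wprod_cat -expg2 rotu eqxx andbT.
    by rewrite big_cat /= -big_split; apply: eq_bigr => x _; rewrite expr2.
  have sz (t : T) : size (take l t) == l.
    by rewrite size_takel // size_tuple leq_addr.
  exists (fun t : T => Tuple (sz t)) => [u _|t].
    by apply: val_inj; rewrite /= take_size_cat // size_tuple.
  rewrite inE => /andP[_ /eqP tl]; apply: val_inj => /=.
  rewrite -[RHS](cat_take_drop l t); congr (_ ++ _).
  have := congr1 (take l) tl; rewrite /seq.rot take_size_cat //.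
  by rewrite size_drop size_tuple addnK.
rewrite addrAC subrr add0r.
rewrite (partition_big (porbit rotation) predT) //=.
apply: rpred_sum => O _.
pose Q := fun t : T => [&& K (wprod t) & seq.rot l t != t].
have [t0 /andP[Qt0 /eqP t0O]|none] := pickP (fun t : T => Q t && (porbit rotation t == O));
  last by rewrite big_pred0 ?dvdz0 // => t; apply: none.
have inv t : t \in porbit rotation t0 ->
    Q t /\ \prod_(x <- t) w x = \prod_(x <- t0) w x.
  case/porbitP=> k ->; rewrite permX; elim: k => [//|k [Qk Wk]].
  rewrite iterS permE prod_rot1 Wk; split=> //.
  move: Qk; rewrite /Q; have [g ->] := wprod_rot1 (iter k rotation t0).
  by rewrite KJ /= rot_rot (inj_eq (@seq.rot_inj _ _)).
rewrite (eq_bigl (mem O)) => [|t].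
  rewrite (eq_bigr (fun=> \prod_(x <- t0) w x)) => [|t]; last first.
    by rewrite -t0O => /inv[].
  rewrite sumr_const -t0O (card_porbit_rotation lm) ?(andP Qt0).2 //.
  by rewrite -mulr_natr natz dvdz_mull.
apply/andP/idP=> [[_ /eqP <-]|tO]; first exact: porbit_id.
have tt0 : t \in porbit rotation t0 by rewrite t0O.
by split; [have [] := inv _ tt0 | rewrite -t0O eq_porbit_mem].
Qed.

End Rotation.

(** Iterating wsum_double, the words left over are powers of exponent 2 ^ a, and
    the products of these are not in K. *)
Lemma dvdz_wsum a m w K :
    (forall x g, K (x ^ g)%g = K x) -> (forall x, ~~ K (x ^+ (2 ^ a))%g) ->
  ((2 ^ (m - a))%N%:Z %| wsum (2 ^ m) w K)%Z.
Proof.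
elim: a m w K => [|a IHa] m w K KJ Ka.
  rewrite /wsum big_pred0 ?dvdz0 // => t; apply/negbTE.
  by have := Ka (wprod t); rewrite expg1.
case: m => [|m]; first by rewrite sub0n dvd1z.
rewrite subSS expnS mul2n -addnn.
have d := wsum_double (l := (2 ^ m)%N) w erefl KJ.
rewrite -(subrK (wsum (2 ^ m) (fun x => w x ^+ 2) (fun x => K (x ^+ 2)%g)) (wsum _ w K)).
apply: rpredD.
  apply: dvdz_trans d; rewrite addnn -mul2n -expnS.
  by rewrite dvdzE !absz_nat dvdn_exp2l //; lia.
apply: IHa => [x g|x]; first by rewrite -conjXg KJ.
by rewrite -expgM mulnC -expnS.
Qed.

(** The powers of e are proportional to e by odd factors, so by dvdz_wsum the
    sum is divisible by all powers of two. *)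
Lemma odd_quasi_idem_sum (e : gT -> int) (h : int) K :
    conv e e =1 (fun g => h * e g) -> odd `|h| ->
    (forall x g, K (x ^ g)%g = K x) -> (forall x, K x -> ~~ odd #[x]%g) ->
  \sum_(g | K g) e g = 0.
Proof.
move=> ee h_odd KJ Keven; set s := LHS.
(* a power of exponent the full 2-part of the group order has odd order *)
have [a Ka] : exists a, forall x, ~~ K (x ^+ (2 ^ a))%g.
  exists (logn 2 #|[set: gT]|) => x; apply/negP => /Keven/negP; apply.
  rewrite -p_part; set c := #|_|; set k := ((#[x]%g)`_2^')%N.
  have k_odd : odd k by rewrite odd_2'nat part_pnat.
  apply: dvdn_odd k_odd; rewrite order_dvdn -expgM -order_dvdn.
  rewrite -{1}(partnC 2%N (order_gt0 x)) dvdn_mul //.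
  by apply: partn_dvd; rewrite ?cardG_gt0 // order_dvdG ?inE.
have pow m : (2 ^ m %| `|s|)%N.
  have := dvdz_wsum (a + m) e KJ Ka.
  rewrite -[(2 ^ (a + m))%N]prednK ?expn_gt0 // (wsum_power _ _ ee) addKn.
  rewrite dvdzE abszM absz_nat Gauss_dvdr // abszX.
  by apply: coprimeXl; apply: coprimeXr; rewrite coprime2n.
apply/eqP; rewrite -absz_eq0 -leqn0 leqNgt; apply/negP => s_gt0.
have := dvdn_leq s_gt0 (pow `|s|%N).
by rewrite leqNgt ltn_expl.
Qed.

End Words.

(** * The staircase as a set of cells *)

(** The coordinates a and b stand for rows and columns in either order: rows are
    swept into columns for the injectivity, columns into rows for the parity. *)
Section AbstractStaircase.

Variables (N n : nat) (a b : 'I_N -> nat).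
Hypothesis ab_inj : forall p q, a p = a q -> b p = b q -> p = q.
Hypothesis ab_lt : forall p, (a p + b p < n)%N.
Hypothesis ab_surj : forall i j, (i + j < n)%N -> exists p, a p = i /\ b p = j.

Let L : eqType := (bool * nat)%type.
Let s (i : nat) : L := (false, i).
Let t (i : nat) : L := (true, i).

Let s_inj : injective s. Proof. by move=> i j []. Qed.
Let t_inj : injective t. Proof. by move=> i j []. Qed.
Let s_neq_t i j : s i != t j. Proof. by []. Qed.

Definition acol : {ffun 'I_N -> L} := [ffun p => s (a p)].
Definition bcol : {ffun 'I_N -> L} := [ffun p => t (b p)].
Local Notation u := acol.
Local Notation v := bcol.
Local Notation word := (letters s t (stair_cells n n)).

Lemma ncol_acol l : ncol l u = if l is (false, m) then (n - m)%N else 0%N.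
Proof.
case: l => [[] m]; first by apply: eq_card0 => p; rewrite !inE ffunE.
rewrite /ncol cardE -(size_map b) -[RHS](size_iota 0).
apply: perm_size; apply: uniq_perm.
- rewrite map_inj_in_uniq ?enum_uniq // => p q; rewrite !mem_enum !inE !ffunE.
  by move=> /eqP[ap] /eqP[aq]; apply: ab_inj; rewrite ap aq.
- exact: iota_uniq.
move=> j; rewrite mem_iota leq0n add0n; apply/mapP/idP=> [[p]|jm].
  by rewrite mem_enum inE ffunE => /eqP[<-] ->; have := ab_lt p; lia.
have [|p [ap bp]] := ab_surj (i := m) (j := j); first by lia.
by exists p; rewrite // mem_enum inE ffunE ap.
Qed.

Lemma ncol_bcol l : ncol l v = if l is (true, m) then (n - m)%N else 0%N.
Proof.
case: l => [[] m]; last by apply: eq_card0 => p; rewrite !inE ffunE.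
rewrite /ncol cardE -(size_map a) -[RHS](size_iota 0).
apply: perm_size; apply: uniq_perm.
- rewrite map_inj_in_uniq ?enum_uniq // => p q; rewrite !mem_enum !inE !ffunE.
  by move=> /eqP[bp] /eqP[bq] apq; apply: ab_inj; rewrite // bp bq.
- exact: iota_uniq.
move=> j; rewrite mem_iota leq0n add0n; apply/mapP/idP=> [[p]|jm].
  by rewrite mem_enum inE ffunE => /eqP[<-] ->; have := ab_lt p; lia.
have [|p [ap bp]] := ab_surj (i := j) (j := m); first by lia.
by exists p; rewrite // mem_enum inE ffunE bp.
Qed.

Lemma mem_stair_cells k i j : ((i, j) \in stair_cells n k) = (i < k)%N && (i + j < n)%N.
Proof.
elim: k => //= k IHk; rewrite mem_cat {}IHk ltnS.
have -> : ((i, j) \in [seq (k, j0) | j0 <- iota 0 (n - k)]) = (i == k) && (i + j < n)%N.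
  apply/mapP/andP=> [[j'] |[/eqP-> ij]].
    by rewrite mem_iota => ? [-> ->]; rewrite eqxx; split=> //; lia.
  by exists j; rewrite // mem_iota; lia.
by rewrite [(i <= k)%N]leq_eqVlt andb_orl.
Qed.

Lemma uniq_stair_cells k : uniq (stair_cells n k).
Proof.
elim: k => //= k IHk; rewrite cat_uniq IHk andbT map_inj_uniq ?iota_uniq /=.
  by apply/hasPn=> -[i j]; rewrite mem_stair_cells => /andP[ik _];
     apply/mapP=> -[j' _ [ei _]]; rewrite ei ltnn in ik.
by move=> j j' [].
Qed.

Lemma sweep_cells : exists c : seq 'I_N,
  [/\ [seq (v p, u p) | p <- c] = word, uniq c & forall p, p \in c].
Proof.
have [c cw] : exists c : seq 'I_N, [seq (v p, u p) | p <- c] = word.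
  have : all (fun ij => ij.1 + ij.2 < n)%N (stair_cells n n).
    by apply/allP=> -[i j]; rewrite mem_stair_cells => /andP[].
  elim: (stair_cells n n) => [|[i j] l IHl /=]; first by exists [::].
  case/andP=> ij /IHl[c cw]; have [|p [ap bp]] := ab_surj (i := j) (j := i).
    by rewrite addnC.
  by exists (p :: c); rewrite /= cw !ffunE ap bp.
exists c; split=> // [|p].
  apply: (@map_uniq _ _ (fun p => (v p, u p))); rewrite cw map_inj_uniq.
    exact: uniq_stair_cells.
  by move=> [i j] [i' j'] [-> ->].
have : (v p, u p) \in word.
  rewrite !ffunE; apply/mapP; exists (b p, a p) => //.
  by have := ab_lt p; rewrite mem_stair_cells; lia.
rewrite -cw => /mapP[q qc []]; rewrite !ffunE => -[bpq] [apq].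
by rewrite (ab_inj apq bpq).
Qed.

Lemma sweep_symmetrize (V : zmodType) (f : {ffun 'I_N -> L} -> V) :
  hops word f v = \sum_(g : 'S_N | pull v g == v) f (pull u g).
Proof.
have [c [<- cu call]] := sweep_cells.
by apply: hops_symmetrize => // p q; rewrite !ffunE.
Qed.

Lemma unsweep_symmetrize (V : zmodType) (f : {ffun 'I_N -> L} -> V) :
  hops (swap_letters word) f u = \sum_(g : 'S_N | pull u g == u) f (pull v g).
Proof.
have [c [<- cu call]] := sweep_cells.
rewrite /swap_letters -map_comp -map_rev; apply: hops_symmetrize => [p q||p].
- by rewrite !ffunE.
- by rewrite rev_uniq.
by rewrite mem_rev.
Qed.

Lemma stage_acol (V : zmodType) (f : {ffun 'I_N -> L} -> V) :
  (forall x, f x != 0 -> forall l, ncol l x = ncol l u) -> stage n s t 0 n f.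
Proof.
move=> fu x /fu xu; split=> [m|k _||//]; rewrite xu ncol_acol // ?subn0 ?subnn //.
by case: (leqP n m) => /=; lia.
Qed.

(** The colourings x for which x and the colouring v together distinguish the
    positions as the cells of the staircase. *)
Definition transversal (x : {ffun 'I_N -> L}) : bool :=
  [exists g : 'S_N, (pull v g == v) && (x == pull u g)].

(** If turning one letter i into a larger letter j produces a transversal, the
    row concerned contained the letter i twice, as the staircase has a cell in
    column i of every row with a cell in column j. Either copy can be turned
    into j, so modulo two the contributions cancel. *)
Lemma transversal_highest :
  highest s (fun x => (transversal x)%:R : 'F_2).
Proof.
move=> i j ij y; rewrite /hop.
pose A := [set p | (y p == s i) && transversal (recolour y p (s j))].
rewrite (eq_bigr (fun p => if p \in A then 1 else 0)) => [|p /eqP yp]; last first.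
  by rewrite inE yp eqxx; case: transversal.
rewrite -big_mkcondr (eq_bigl (mem A)) => [|p]; last first.
  by rewrite /= inE; case: eqP.
have [->|[p pA]] := set_0Vmem A; first by rewrite big_set0.
have := pA; rewrite inE => /andP[/eqP yp /existsP[r /andP[/pull_fixP vr /eqP xr]]].
set x := recolour y p (s j) in xr.
have xE q : x (r q) = s (a q) by rewrite xr pullE ffunE.
have vE q : v (r q) = t (b q) by rewrite vr ffunE.
pose k := (r^-1 p)%g; have rk : r k = p by rewrite permKV.
have ak : a k = j by have := xE k; rewrite rk ffunE eqxx => -[].
have [|k' [ak' bk']] := ab_surj (i := i) (j := b k).
  by have := ab_lt k; rewrite ak; lia.
pose p' := r k'; have xp' : x p' = s i by rewrite xE ak'.
have vp' : v p' = v p by rewrite -rk !vE bk'.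
have pp' : p' != p.
  by apply/eqP=> e; have := xp'; rewrite e ffunE eqxx => -[ji]; rewrite ji ltnn in ij.
have yp' : y p' = s i by move: xp'; rewrite ffunE (negPf pp').
have -> : A = [set p; p'].
  apply/setP=> q; rewrite inE; apply/idP/idP; last first.
    case/set2P=> ->; first by move: pA; rewrite inE.
    rewrite yp' eqxx /=; apply/existsP; exists (r * tperm p p')%g.
    apply/andP; split.
      apply/pull_fixP=> z; rewrite permM.
      by case: tpermP => [e|e|_ _]; [rewrite -(vr z) e | rewrite -(vr z) e | rewrite vr].
    rewrite pullM -xr; apply/eqP/ffunP=> z; rewrite !ffunE tpermV.
    case: tpermP => [->|->|/eqP zp /eqP zp'].
    - by rewrite (negPf pp') eq_sym (negPf pp') yp' yp.
    - by rewrite !eqxx.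
    by rewrite (negPf zp) (negPf zp').
  case/andP=> /eqP yq /existsP[r' /andP[/pull_fixP vr' /eqP xr']].
  rewrite !inE; case: eqVneq => //= qp; apply/eqP; apply: contraTeq isT => qp'.
  have ar' z : z != q -> y z = s i -> a (r'^-1 z)%g = i.
    move=> zq yz; have := congr1 (fun w : {ffun 'I_N -> L} => w z) xr'.
    by rewrite !ffunE (negPf zq) yz => -[].
  have br' z : t (b (r'^-1 z)%g) = v z.
    by rewrite -{2}(permKV r' z) vr' ffunE.
  case/eqP: pp'; apply: (@perm_inj _ r'^-1%g); apply: ab_inj.
    by rewrite !ar' // eq_sym.
  by apply: t_inj; rewrite !br'.
rewrite big_setU1 ?inE 1?eq_sym //= big_set1.
by apply/val_inj.
Qed.

(** The back and forth sweep of the indicator of the transversals, evaluated at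
    the transversal u itself. *)
Lemma transversal_parity :
  \sum_(c : 'S_N | pull u c == u) \sum_(r : 'S_N | pull v r == v)
     (transversal (pull u (r * c)%g))%:R = 1 :> 'F_2.
Proof.
pose f x : 'F_2 := (transversal x)%:R.
have fS : stage n s t 0 n f.
  apply: stage_acol => x; rewrite /f /transversal; case: existsP => // -[g].
  by case/andP=> _ /eqP-> _ l; rewrite ncol_pull.
have F2 (x : 'F_2) : x + x = 0 by apply: val_inj; case: x => [[|[]]].
have := unsweep s_inj t_inj s_neq_t F2 fS transversal_highest u.
rewrite unsweep_symmetrize [in RHS]/f (_ : transversal u) //; last first.
  by apply/existsP; exists 1%g; rewrite !pull1 !eqxx.
move=> e1; apply: etrans e1; apply: eq_bigr => c _.
by rewrite -hops_pull sweep_symmetrize; apply: eq_bigr => r _; rewrite pullM.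
Qed.

End AbstractStaircase.

(** * The Young symmetrizer of the staircase modulo two *)

Section Staircase.

Variable n : nat.
Local Notation N := 'C(n.+1, 2).
Local Notation sh := (staircase n).
Local Notation row := (fun p : 'I_N => reshape_index sh p).
Local Notation col := (fun p : 'I_N => reshape_offset sh p).
Local Notation R := (row_stab N sh).
Local Notation C := (col_stab N sh).

Lemma nth_staircase i : nth 0%N sh i = (n - i)%N.
Proof.
have [i_lt|n_le] := ltnP i n; last first.
  by rewrite nth_default ?size_rev ?size_iota //; lia.
by rewrite nth_rev ?size_iota // nth_iota; lia.
Qed.

Lemma sumn_staircase : sumn sh = N.
Proof.
rewrite /staircase sumn_rev sumnE -bin2_sum [RHS]big_ltn // add0n.
by rewrite /index_iota subn1.
Qed.

Lemma staircase_cell_lt p : (row p + col p < n)%N.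
Proof. by have := col_lt sumn_staircase p; rewrite nth_staircase; lia. Qed.

Lemma staircase_cellP i j : (i + j < n)%N -> exists p, row p = i /\ col p = j.
Proof. by move=> ij; apply: (cellP sumn_staircase); rewrite nth_staircase; lia. Qed.

Let cell_eq p q : col p = col q -> row p = row q -> p = q.
Proof. by move=> cpq rpq; apply: cell_inj rpq cpq. Qed.

Let cell_lt p : (col p + row p < n)%N.
Proof. by rewrite addnC staircase_cell_lt. Qed.

Let cell_ex i j : (i + j < n)%N -> exists p, col p = i /\ row p = j.
Proof. by rewrite addnC => /staircase_cellP[p []]; exists p. Qed.

Lemma pull_acol_row g : (pull (acol row) g == acol row) = (g \in R).
Proof.
apply/pull_fixP/row_stabP=> gR k; last by rewrite !ffunE gR.
by have := gR k; rewrite !ffunE => -[].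
Qed.

Lemma pull_bcol_row g : (pull (bcol row) g == bcol row) = (g \in R).
Proof.
apply/pull_fixP/row_stabP=> gR k; last by rewrite !ffunE gR.
by have := gR k; rewrite !ffunE => -[].
Qed.

Lemma pull_acol_col g : (pull (acol col) g == acol col) = (g \in C).
Proof.
apply/pull_fixP/col_stabP=> gR k; last by rewrite !ffunE gR.
by have := gR k; rewrite !ffunE => -[].
Qed.

Lemma pull_bcol_col g : (pull (bcol col) g == bcol col) = (g \in C).
Proof.
apply/pull_fixP/col_stabP=> gR k; last by rewrite !ffunE gR.
by have := gR k; rewrite !ffunE => -[].
Qed.

Let RG := Group (row_stab_group N sh).
Let CG := Group (col_stab_group N sh).

(** Modulo two the symmetrizer is the indicator of the products r c, and these
    are recognized by their action on column colours. *)
Lemma ycoef_F2 g : ycoef sh 'F_2 g^-1%g = (transversal col row (pull (acol col) g))%:R.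
Proof.
rewrite /transversal; case: existsP => [[r]|none].
  rewrite pull_bcol_row => /andP[Rr /eqP gr].
  have Cc : (g * r^-1)%g \in C by rewrite -pull_acol_col pullM gr -pullM mulgV pull1.
  have -> : (g^-1 = r^-1 * (g * r^-1)^-1)%g by rewrite invMg invgK mulKg.
  rewrite ycoef_factor ?(groupV RG) ?(groupV CG) //.
  by case: odd_perm => //; apply: val_inj.
rewrite /ycoef big_pred0 // => -[r c] /=; rewrite in_setX /=.
apply/negP=> /andP[/andP[Rr Cc] /eqP rc]; case: none; exists r^-1%g.
rewrite pull_bcol_row (groupV RG) Rr /=.
have -> : g = (c^-1 * r^-1)%g by rewrite -invMg rc invgK.
have /eqP cc : pull (acol col) c^-1 == acol col by rewrite pull_acol_col (groupV CG).
by rewrite pullM cc.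
Qed.

Lemma yscalar_F2 : yscalar N sh 'F_2 = 1.
Proof.
rewrite -(transversal_parity cell_eq cell_lt cell_ex) exchange_big /=.
under [RHS]eq_bigr => r Rr do under eq_bigr => c Cc do rewrite -ycoef_F2.
rewrite pair_big_dep /= /yscalar /conv.
under [LHS]eq_bigr => x _ do rewrite mulg1 {1}/ycoef big_distrl /=.
rewrite (exchange_big_dep (mem (setX R C))) /=; last by move=> x p _ /andP[].
apply: eq_big => [[r c]|[r c] RC] /=.
  by rewrite in_setX pull_bcol_row pull_acol_col.
rewrite (big_pred1 (r * c)%g) => [|x]; last by rewrite /= RC eq_sym.
by rewrite (_ : (-1) ^+ _ = 1) ?mul1r //; case: odd_perm => //; apply: val_inj.
Qed.

Lemma ycoef_intr (K : comNzRingType) (g : 'S_N) : ycoef sh K g = (ycoef sh int g)%:~R.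
Proof.
rewrite /ycoef rmorph_sum; apply: eq_bigr => p _.
by rewrite rmorphXn rmorphN1.
Qed.

Lemma yscalar_odd : odd `|yscalar N sh int|.
Proof.
have : (yscalar N sh int)%:~R = 1 :> 'F_2.
  transitivity (yscalar N sh 'F_2); last exact: yscalar_F2.
  rewrite /yscalar /conv rmorph_sum; apply: eq_bigr => x _.
  by rewrite rmorphM /= -!ycoef_intr.
set z := yscalar N sh int; rewrite [z in z%:~R]intEsign rmorphM rmorph_sign /=.
rewrite (_ : (-1) ^+ _ = 1) ?mul1r; last by case: (z < 0)%R => //; apply: val_inj.
rewrite -{1}(odd_double_half `|z|%N); case: odd => //.
rewrite add0n -addnn PoszD rmorphD /= => z1.
have F2 (x : 'F_2) : x + x = 0 by apply: val_inj; case: x => [[|[]]].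
by move: z1; rewrite F2 => /eqP; rewrite eq_sym oner_eq0.
Qed.

(** The sum of the coefficients at all conjugates of x^-1 is a multiple of the
    sum over a class, to which odd_quasi_idem_sum applies. *)
Lemma kappa_even_order (F : fieldType) (x : 'S_N) :
  [pchar F] =i pred0 -> ~~ odd #[x]%g -> kappa F sh x = 0.
Proof.
move=> charF0 x_even; set y := x^-1%g.
have ysum : \sum_(g | g \in (y ^: [set: 'S_N])%g) ycoef sh int g = 0.
  apply: odd_quasi_idem_sum yscalar_odd _ _.
  - by apply: conv_ycoef; [exact: sumn_staircase | move=> z; lia].
  - by move=> z g /=; rewrite memJ_norm // (subsetP (class_norm _ _)) ?inE.
  by move=> _ /imsetP[g _ ->]; rewrite orderJ orderV.
have conjsum k : \sum_(g | g \in (y ^: [set: 'S_N])%g) ycoef sh int (g ^ k)%g = 0.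
  apply: etrans ysum; rewrite [RHS](reindex_inj (conjg_inj k)) /=.
  apply: eq_bigl => g.
  by rewrite memJ_norm // (subsetP (class_norm _ _)) ?inE.
have total : \sum_g ycoef sh int (y ^ g)%g = 0.
  apply/eqP; suff: (\sum_g ycoef sh int (y ^ g)%g) *+ #|(y ^: [set: 'S_N])%g| == 0.
    rewrite Num.Theory.mulrn_eq0 => /orP[|//]; rewrite cards_eq0 => /eqP y0.
    by have := class_refl [set: 'S_N] y; rewrite y0 inE.
  rewrite -sumr_const (eq_bigr (fun z => \sum_g ycoef sh int (z ^ g)%g)).
    by rewrite exchange_big big1 // => g _; apply: conjsum.
  move=> _ /imsetP[k _ ->]; rewrite (reindex_inj (mulgI k)) /=.
  by apply: eq_bigr => g _; rewrite conjgM.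
rewrite /kappa -[RHS](rmorph0 (intmul 1)) -[in RHS]total rmorph_sum.
rewrite (reindex_inj invg_inj); apply: eq_bigr => g _ /=.
by rewrite ycoef_intr conjgE invgK mulgA.
Qed.

Lemma staircase_char_even_order (F : fieldType) (x : 'S_N) :
  [pchar F] =i pred0 -> ~~ odd #[x]%g -> \tr (specht F N sh x) = 0.
Proof.
move=> charF0 x_even; have := kappa_char charF0 sumn_staircase x.
rewrite kappa_even_order // => /esym/eqP; rewrite mulf_eq0.
by rewrite (negPf (yscalar_neq0 charF0 sumn_staircase)) => /eqP.
Qed.

End Staircase.

(** * Invariants of Young subgroups as functions of colourings *)

Section Equivariant.

Variables (F : fieldType) (N m : nat) (rW : mx_representation F (symgroup N) m).
Variable L : eqType.

Local Notation colouring := {ffun 'I_N -> L}.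
Implicit Types (f : colouring -> 'rV[F]_m) (w : 'rV[F]_m) (x y : colouring).

Definition equivariant f := forall x g, f (pull x g) = f x *m rW g.

(** For w invariant under the stabiliser of y this is, up to a positive factor,
    the equivariant function on the orbit of y with value w at y; summing over
    all g avoids choosing representatives. *)
Definition orbit_fun y w : colouring -> 'rV[F]_m :=
  fun x => \sum_(g : 'S_N | x == pull y g) w *m rW g.

Lemma orbit_fun_equivariant y w : equivariant (orbit_fun y w).
Proof.
move=> x k; rewrite /orbit_fun (reindex_inj (mulIg k)) mulmx_suml /=.
apply: eq_big => [g|g _]; first by rewrite pullM (inj_eq (@pull_inj _ _ k)).
by rewrite repr_mxM ?inE // mulmxA.
Qed.

Lemma orbit_fun_support y w x : orbit_fun y w x != 0 -> exists g, x = pull y g.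
Proof.
have [/existsP[g /eqP->] _|none] := boolP [exists g, x == pull y g]; first by exists g.
case/eqP; rewrite /orbit_fun big_pred0 // => g; apply: contraNF none => xg.
by apply/existsP; exists g.
Qed.

Lemma orbit_fun_base y w :
    (forall g, pull y g == y -> w *m rW g = w) ->
  exists2 k, (0 < k)%N & orbit_fun y w y = w *+ k.
Proof.
move=> wy; exists #|[pred g : 'S_N | y == pull y g]|.
  by apply/card_gt0P; exists 1%g; rewrite inE pull1.
rewrite /orbit_fun (eq_bigr (fun=> w)) ?sumr_const // => g; rewrite eq_sym.
exact: wy.
Qed.

Lemma equivariant_hop a b f : equivariant f -> equivariant (hop a b f).
Proof.
move=> fE x g; rewrite -hop_pull (eq_hop _ _ (fE^~ g)).
by rewrite /hop mulmx_suml.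
Qed.

Lemma equivariant_hops l f : equivariant f -> equivariant (hops l f).
Proof. by move=> fE; elim: l => //= ab l; apply: equivariant_hop. Qed.

End Equivariant.

Section StaircaseInvariants.

Variables (F : fieldType) (n m : nat).
Local Notation N := 'C(n.+1, 2).
Local Notation sh := (staircase n).
Variable rW : mx_representation F (symgroup N) m.
Hypothesis charF0 : [pchar F] =i pred0.

(** The sum over the column group is, up to a positive factor, the value of the
    swept function f at the column colouring v. As sweeping is injective, the
    swept function is not zero, and by equivariance neither is its value at v,
    since all colourings in its support have the content of v. *)
Lemma staircase_row_to_col (w : 'rV[F]_m) : w != 0 ->
    (forall r, r \in row_stab N sh -> w *m rW r = w) ->
  w *m \sum_(c in col_stab N sh) rW c != 0.
Proof.
move=> w_neq0 wR.
pose row (p : 'I_N) := reshape_index sh p; pose col (p : 'I_N) := reshape_offset sh p.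
have rc_inj p q : row p = row q -> col p = col q -> p = q by apply: cell_inj.
have rc_lt p : (row p + col p < n)%N by apply: staircase_cell_lt.
have rc_ex i j : (i + j < n)%N -> exists p, row p = i /\ col p = j.
  exact: staircase_cellP.
pose L : eqType := (bool * nat)%type.
pose s (i : nat) : L := (false, i); pose t (i : nat) : L := (true, i).
have s_inj : injective s by move=> i j [].
have t_inj : injective t by move=> i j [].
have st i j : s i != t j by [].
pose u := acol row; pose v := bcol col.
pose f := orbit_fun rW u w.
have fu : f u != 0.
  have [|k k_gt0] := @orbit_fun_base _ _ _ rW _ u w; last rewrite -/f => ->.
    by move=> g; rewrite pull_acol_row; apply: wR.
  by apply: contraNneq w_neq0 => /(pchar0_mulrn charF0 k_gt0) ->.
have fS : stage n s t 0 n f.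
  apply: (stage_acol rc_inj rc_lt rc_ex) => x /orbit_fun_support[g ->] l.
  exact: ncol_pull.
pose g := hops (letters s t (stair_cells n n)) f.
have fE : equivariant rW f by apply: orbit_fun_equivariant.
have gE : equivariant rW g by apply: equivariant_hops.
have v_neq : g v != 0.
  apply: contraNneq fu => gv0; apply/eqP.
  apply: (sweep_injective s_inj t_inj st _ fS); first exact: pchar0_mulrn.
  move=> z; apply/eqP/negPn/negP => gz.
  have [|k zk] := @pull_transitive _ _ v z; last by case/eqP: gz; rewrite -/(g z) zk gE gv0 mul0mx.
  have [zs zt ztn ztk] := stage_sweep s_inj t_inj st (leqnn n) fS gz.
  move=> [[] i].
    rewrite (ncol_bcol rc_inj rc_lt rc_ex) /=; case: (ltngtP i n) => [ni|ni|->].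
    - by rewrite (ztk i ni).
    - by rewrite (zt i ni); lia.
    by rewrite ztn; lia.
  by rewrite (ncol_bcol rc_inj rc_lt rc_ex) (zs i) /=; lia.
have : g v = (w *m \sum_(c in col_stab N sh) rW c) *+ #|[pred r : 'S_N | u == pull u r]|.
  rewrite /g (sweep_symmetrize rc_inj rc_lt rc_ex) mulmx_sumr -sumrMnl.
  apply: eq_big => [c|c _]; first exact: pull_bcol_col.
  rewrite fE {1}/f /orbit_fun (eq_bigr (fun=> w)) => [|r]; last first.
    by rewrite eq_sym pull_acol_row; apply: wR.
  by rewrite sumr_const -!scaler_nat scalemxAl.
by move=> gvE; apply: contraNneq v_neq => w0; rewrite gvE w0 mul0rn.
Qed.

End StaircaseInvariants.

(** * Tensor products *)

Section Tensor.

Variables (F : fieldType) (p q : nat).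

Lemma trow_mul p' q' (u : 'rV[F]_p) (w : 'rV[F]_q) (A : 'M[F]_(p, p')) (B : 'M[F]_(q, q')) :
  trow (u *m A) (w *m B) = trow u w *m tprod A B.
Proof.
have us k (x : 'rV[F]_k) : usubmx (x : 'M_(1 + 0, k)) = x.
  by apply/matrixP=> i j; rewrite !mxE; congr (x _ _); apply: val_inj; rewrite /= ord1.
have := tprodE (u : 'M_(1 + 0, p)) A w B => /=.
move=> e; have {e} := etrans e (@mul_col_mx _ 1 (0 * 1) _ _ _ _ _).
by move=> /eq_col_mx[]; rewrite !us.
Qed.

Lemma trow_neq0 (u : 'rV[F]_p) (w : 'rV[F]_q) : u != 0 -> w != 0 -> trow u w != 0.
Proof.
move=> u0 w0.
have /row_freeP[u' uu'] : row_free u by rewrite /row_free rank_rV u0.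
have /row_freeP[w' ww'] : row_free w by rewrite /row_free rank_rV w0.
apply/eqP=> uw0; have := trow_mul u w u' w'; rewrite uw0 mul0mx uu' ww' /=.
move/(congr1 (fun M : 'M[F]_(1, 1 + 0) => M 0 (lshift 0 0))).
rewrite row_mxEl !mxE eqxx mulr1 => /eqP.
by rewrite -(inj_eq val_inj) /= oner_eq0.
Qed.

End Tensor.

Section YoungTensor.

Variables (F : fieldType) (N : nat) (sh : seq nat).
Variables (p q : nat) (rV : mx_representation F (symgroup N) p)
  (rW : mx_representation F (symgroup N) q).
Hypothesis charF0 : [pchar F] =i pred0.
Local Notation R := (row_stab N sh).
Local Notation C := (col_stab N sh).

(** Choose a row invariant v in the first factor with v B nonzero. Applying the
    column antisymmetrizer to v (x) w, and then B to the first factor only,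
    gives v B (x) (w summed over the column group), because c B = sgn(c) B
    cancels the sign of c. *)
Lemma ycoef_tensor (w : 'rV[F]_q) :
    opf rV (ycoef sh F) != 0 ->
    (forall r, r \in R -> w *m rW r = w) ->
    w *m \sum_(c in C) rW c != 0 ->
  opf (prod_repr rV rW) (ycoef sh F) != 0.
Proof.
rewrite -!symmetrizer_opf; set A := \sum_(r in R) rV r.
set B := \sum_(c in C) _ => AB wR wC.
pose RG := Group (row_stab_group N sh); pose CG := Group (col_stab_group N sh).
have [i vB] : exists i, row i A *m B != 0.
  apply/existsP; apply: contraNT AB => /existsPn/= AB0; apply/eqP/row_matrixP=> i.
  by rewrite row_mul row0; apply/eqP/negPn.
set v := row i A in vB.
have Ar r : r \in R -> v *m rV r = v.
  move=> Rr; rewrite /v -row_mul; congr row; rewrite mulmx_suml.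
  rewrite [RHS](reindex_inj (mulIg r)) /=; apply: eq_big => [g|g _].
    by rewrite (groupMr (G := RG)).
  by rewrite repr_mxM ?inE.
have cB c : c \in C -> rV c *m B = (-1) ^+ odd_perm c *: B.
  move=> Cc; rewrite mulmx_sumr scaler_sumr [RHS](reindex_inj (mulgI c)) /=.
  apply: eq_big => [g|g _]; first by rewrite (groupMl (G := CG)).
  rewrite -scalemxAr repr_mxM ?inE // scalerA odd_permM signr_addb mulrA.
  by rewrite -signr_addb addbb mul1r.
pose u := trow v w.
have uR : u *m \sum_(r in R) prod_repr rV rW r = u *+ #|R|.
  rewrite mulmx_sumr -sumr_const; apply: eq_bigr => r Rr.
  by rewrite /= -trow_mul Ar // wR.
have uC : u *m (\sum_(c in C) (-1) ^+ odd_perm c *: prod_repr rV rW c) *m tprod B 1%:M =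
    trow (v *m B) (w *m \sum_(c in C) rW c).
  rewrite mulmx_sumr mulmx_suml (mulmx_sumr w) [RHS]linear_sum; apply: eq_bigr => c Cc.
  rewrite -scalemxAr -scalemxAl /= -!trow_mul mulmx1 -mulmxA cB // -scalemxAr.
  by rewrite -trowbE linearZ /= scalerA -signr_addb addbb scale1r.
have : trow (v *m B) (w *m \sum_(c in C) rW c) *+ #|R| != 0.
  have R_gt0 : (0 < #|R|)%N by apply/card_gt0P; exists 1%g; apply: (group1 RG).
  by apply: contra_neq (trow_neq0 vB wC) => /(pchar0_mulrn charF0 R_gt0).
apply: contra_neq => e0.
rewrite -uC -scaler_nat !scalemxAl scaler_nat -uR.
by rewrite -(mulmxA u) e0 mulmx0 mul0mx.
Qed.

End YoungTensor.

(** * Invariants of the row group of the staircase *)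

Section RowInvariants.

Variables (F : fieldType) (N m : nat) (rW : mx_representation F (symgroup N) m).
Hypothesis charF0 : [pchar F] =i pred0.
Hypothesis even0 : forall x, ~~ odd #[x]%g -> \tr (rW x) = 0.

Local Notation colouring := {ffun 'I_N -> nat}.
Implicit Types (f : colouring -> 'rV[F]_m) (x y : colouring) (c : nat -> nat).

(** No invariants for the Young subgroups of type c. This negative form does not
    require exhibiting functions, and passes backwards along injections. *)
Definition void c := forall f, equivariant rW f ->
  (forall x, f x != 0 -> forall l, ncol l x = c l) -> f =1 (fun=> 0).

Lemma eq_void c c' : c =1 c' -> void c -> void c'.
Proof.
by move=> cc vc f fE fc; apply: vc => // x fx l; rewrite cc; apply: fc.
Qed.

Definition move_box c (a b : nat) : nat -> nat :=
  fun l => if l == a then (c l).+1 else if l == b then (c l).-1 else c l.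

(** A box moves from the longer part b to the shorter part a, which is injective
    on invariants. *)
Lemma void_balance c a b d : a != b -> (0 < d)%N -> c b = (c a + d)%N ->
  void (move_box c a b) -> void c.
Proof.
move=> ab d_gt0 cd vc f fE fc.
apply: (hop_injective (s := b) (t := a) (d := d)) => //.
- exact: pchar0_mulrn.
- by rewrite eq_sym.
- by move=> x fx; rewrite !fc.
apply: vc; first exact: equivariant_hop.
move=> y /hop_neq0[p [yp /fc yc]] l; have := ncol_recolour l y p b.
rewrite yc yp /move_box ![_ == l]eq_sym.
case: (eqVneq l a) => [->|la]; first by rewrite (negPf ab); lia.
by case: eqP; lia.
Qed.

(** Up to a positive factor, the projection onto the invariants of the
    stabiliser of y. *)
Definition fixsum y : 'M[F]_m := \sum_(g : 'S_N | pull y g == y) rW g.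

Lemma fixsum_mul y g : pull y g == y -> fixsum y *m rW g = fixsum y.
Proof.
move=> /eqP yg; rewrite /fixsum mulmx_suml [RHS](reindex_inj (mulIg g)) /=.
apply: eq_big => [h|h _]; last by rewrite repr_mxM ?inE.
by rewrite pullM -[X in _ = (_ == X)]yg (inj_eq (@pull_inj _ _ g)).
Qed.

Lemma fixsum_trace y :
  \tr (fixsum y) = (#|[pred g : 'S_N | pull y g == y]| * \rank (fixsum y))%:R.
Proof.
rewrite natrM; apply: mxtrace_quasi_idem.
rewrite {2}/fixsum mulmx_sumr (eq_bigr (fun=> fixsum y)) => [|g]; last exact: fixsum_mul.
by rewrite sumr_const scaler_nat.
Qed.

Lemma card_stab_gt0 y : (0 < #|[pred g : 'S_N | pull y g == y]|)%N.
Proof. by apply/card_gt0P; exists 1%g; rewrite inE pull1. Qed.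

Lemma void_fixsum y : void (fun l => ncol l y) -> fixsum y = 0.
Proof.
move=> vy; apply/row_matrixP=> i; rewrite row0.
set w := row i _; have wy g : pull y g == y -> w *m rW g = w.
  by move=> yg; rewrite /w -row_mul fixsum_mul.
have [k k_gt0 fy] := orbit_fun_base wy.
apply: (pchar0_mulrn charF0 k_gt0); rewrite -fy.
apply: vy; first exact: orbit_fun_equivariant.
by move=> x /orbit_fun_support[g ->] l; rewrite ncol_pull.
Qed.

Lemma fixsum_neq0 f x : equivariant rW f -> f x != 0 -> fixsum x != 0.
Proof.
move=> fE fx.
have : f x *m fixsum x = f x *+ #|[pred g : 'S_N | pull x g == x]|.
  rewrite mulmx_sumr (eq_bigr (fun=> f x)) ?sumr_const // => g /eqP xg.
  by rewrite -fE xg.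
have k_gt0 := card_stab_gt0 x.
move=> e; apply: contraNneq fx => x0; apply/eqP; apply: (pchar0_mulrn charF0 k_gt0).
by rewrite -e x0 mulmx0.
Qed.

Section Split.

Variables (x : colouring) (a b : nat).
Hypothesis ab : a != b.
Local Notation P := [set p | (x p == a) || (x p == b)].

(** The positions of colour a or b are shared out again, those in A getting a. *)
Definition split_by (A : {set 'I_N}) : colouring :=
  [ffun p => if p \in P then if p \in A then a else b else x p].

Definition sgs (A : {set 'I_N}) : F := \prod_p (-1) ^+ (p \in A).

Lemma split_byP (A : {set 'I_N}) (g : 'S_N) : reflect
  (forall p, [/\ (g p \in P) = (p \in P), p \in P -> (g p \in A) = (p \in A)
             & p \notin P -> x (g p) = x p])
  (pull (split_by A) g == split_by A).
Proof.
apply: (iffP (pull_fixP _ _)) => H p; have := H p; rewrite !ffunE.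
  have [gP|gP] := boolP (g p \in P); have [pP|pP] := boolP (p \in P).
  - by case: ifP; case: ifP => // _ _ e; split=> // _; move: ab; rewrite e eqxx.
  - by move: pP; rewrite inE => /norP[/eqP xa /eqP xb]; case: ifP => _ e; rewrite e in xa xb.
  - by move: gP; rewrite inE => /norP[/eqP xa /eqP xb]; case: ifP => _ e; rewrite e in xa xb.
  by move=> e; split.
move=> [-> pA pX]; case: ifP => [/pA->|/negbT/pX] //.
Qed.

(** Toggling the membership in A of a whole cycle of g, of odd length, is a sign
    reversing involution of the splittings fixed by g. *)
Lemma split_alternating (g : 'S_N) p0 : p0 \in P -> odd #[g]%g ->
  \sum_(A : {set 'I_N} | (A \subset P) && (pull (split_by A) g == split_by A)) sgs A = 0.
Proof.
move=> p0P g_odd; set O := porbit g p0.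
have O_odd : odd #|O|.
  apply: dvdn_odd g_odd; rewrite /O porbit.unlock -[aperm p0 @: _]/(orbit 'P%act <[g]>%g p0).
  by rewrite orderE dvdn_orbit.
have Og p : (g p \in O) = (p \in O).
  by rewrite /O -!eq_porbit_mem -[g p]/((g ^+ 1)%g p) porbit_perm.
pose tog (A : {set 'I_N}) := [set p | (p \in A) (+) (p \in O)].
have togK : involutive tog by move=> A; apply/setP=> p; rewrite !inE addbK.
have sgs_tog A : sgs (tog A) = - sgs A.
  rewrite /sgs (eq_bigr (fun p => (-1) ^+ (p \in A) * (-1) ^+ (p \in O))).
    rewrite big_split /= [X in _ * X](_ : _ = -1) ?mulrN1 //.
    rewrite (bigID (mem O)) /= [X in _ * X]big1 ?mulr1 => [|p /negPf->] //.
    rewrite (eq_bigr (fun=> -1)) => [|p ->] //.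
    by rewrite prodr_const -signr_odd O_odd.
  by move=> p _; rewrite inE signr_addb.
have tog_fix (A : {set 'I_N}) : (A \subset P) && (pull (split_by A) g == split_by A) ->
    (tog A \subset P) && (pull (split_by (tog A)) g == split_by (tog A)).
  case/andP=> AP /split_byP gA.
  have OP p : p \in O -> p \in P.
    case/porbitP=> k ->; rewrite permX; elim: k => // k IHk.
    by have [-> _ _] := gA (iter k g p0).
  apply/andP; split.
    apply/subsetP=> p; rewrite inE; case: (boolP (p \in A)) => [/(subsetP AP)//|_].
    exact: OP.
  apply/split_byP=> p; have [gP gpA gpx] := gA p; split=> // pP.
  by rewrite !inE gpA ?Og.
apply: (pchar0_double charF0); rewrite {1}(reindex_inj (inv_inj togK)) /=.
rewrite (eq_bigr (fun A => - sgs A)) => [|A _]; last exact: sgs_tog.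
rewrite (eq_bigl (fun A : {set 'I_N} => (A \subset P) && (pull (split_by A) g == split_by A))).
  by rewrite sumrN addNr.
by move=> A; apply/idP/idP=> /tog_fix //; rewrite togK.
Qed.

Lemma split_trace_sum p0 : p0 \in P ->
  \sum_(A : {set 'I_N} | A \subset P) sgs A * \tr (fixsum (split_by A)) = 0.
Proof.
move=> p0P.
under eq_bigr => A _ do rewrite linear_sum big_distrr.
rewrite (exchange_big_dep predT) //=; apply: big1 => g _.
rewrite -big_distrl /=; have [g_odd|g_even] := boolP (odd #[g]%g).
  by rewrite (split_alternating p0P) ?mul0r.
by rewrite even0 ?mulr0.
Qed.

Lemma split_byC (A : {set 'I_N}) : fixsum (split_by (P :\: A)) = fixsum (split_by A).
Proof.
apply: eq_bigl => g; apply/split_byP/split_byP=> H p; have [gP gA gx] := H p.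
  split=> // pP; have := gA pP; rewrite !(in_setD, gP) pP !andbT.
  by move/(can_inj negbK).
by split=> // pP; rewrite !(in_setD, gP) gA.
Qed.

Lemma sgsE (A : {set 'I_N}) : sgs A = (-1) ^+ #|A|.
Proof.
rewrite /sgs (bigID (mem A)) /= [X in _ * X]big1 ?mulr1 => [|p /negPf->] //.
by rewrite (eq_bigr (fun=> -1)) ?prodr_const // => p ->.
Qed.

Lemma ncol_split_by (A : {set 'I_N}) l : A \subset P ->
  ncol l (split_by A) = if l == a then #|A| else
                        if l == b then (#|P| - #|A|)%N else ncol l x.
Proof.
move=> AP; have [->|la] := eqVneq l a.
  apply: eq_card => p; rewrite !inE ffunE inE.
  case: (boolP (p \in A)) => pA.
    by have := subsetP AP p pA; rewrite inE => ->; rewrite eqxx.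
  case: ifP => [_|/norP[/negPf-> _] //]; by rewrite eq_sym (negPf ab).
have [->|lb] := eqVneq l b.
  have <- : #|P :\: A| = (#|P| - #|A|)%N by rewrite cardsD (setIidPr AP).
  apply: eq_card => p; rewrite !inE ffunE inE.
  case: (boolP (p \in A)) => pA.
    by have := subsetP AP p pA; rewrite inE => -> /=; rewrite (negPf ab).
  by case: ifP => [_|/norP[_ /negPf->] //]; rewrite eqxx.
apply: eq_card => p; rewrite !inE ffunE inE.
case: ifP => [|//]; case: ifP => _ /orP[]/eqP->.
all: by rewrite ![_ == l]eq_sym ?(negPf la) ?(negPf lb).
Qed.

End Split.

(** If the invariants of type (k + 1, k - 1) vanish, so do those of type
    (k + i, k - i) for all nonzero i, by void_balance. In split_trace_sum only
    the splittings into two parts of size k are left; their terms have the same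
    sign and are dimensions up to positive factors, so all of them vanish. *)
Lemma void_double c a b k : a != b -> (0 < k)%N -> c a = k -> c b = k ->
  void (move_box c a b) -> void c.
Proof.
move=> ab k_gt0 ca cb vc f fE fc x; apply/eqP/negPn/negP => fx.
pose P := [set p | (x p == a) || (x p == b)].
pose ci i l := if l == a then (k + i)%N else if l == b then (k - i)%N else c l.
have vi i : (0 < i <= k)%N -> void (ci i).
  case: i => // i /=; elim: i => [|i IHi] ik.
    apply: eq_void vc => l; rewrite /move_box /ci.
    by case: eqP => [->|_]; [|case: eqP => [->|//]]; lia.
  apply: (@void_balance _ b a (2 * i.+2)); rewrite 1?eq_sym //.
    by rewrite /ci eqxx eq_sym (negPf ab) eqxx; lia.
  apply: eq_void (IHi (ltnW ik)) => l; rewrite /move_box /ci.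
  have [->|la] := eqVneq l a; first by rewrite (negPf ab); lia.
  by case: eqP => // _; lia.
have xc := fc x fx; pose A0 := [set p | x p == a].
have A0k : #|A0| = k by rewrite -ca -xc; apply: eq_card => p; rewrite !inE.
have Pk : #|P| = (k + k)%N.
  rewrite -{1}A0k -cb -xc -[ncol b x]cardsE -cardsUI.
  rewrite [X in (_ + X)%N](_ : _ = 0%N) ?addn0; first by apply: eq_card => p; rewrite !inE.
  apply: eq_card0 => p; rewrite !inE; apply/negP=> /andP[/eqP-> /eqP e].
  by rewrite e eqxx in ab.
have [p0 p0P] : exists p0, p0 \in P by apply/card_gt0P; rewrite Pk; lia.
have big (A : {set 'I_N}) : A \subset P -> (k < #|A|)%N -> fixsum (split_by x a b A) = 0.
  move=> AP kA; apply: void_fixsum.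
  have Ak := subset_leq_card AP; rewrite Pk in Ak.
  apply: (@eq_void (ci (#|A| - k)%N)); last by apply: vi; lia.
  by move=> l; rewrite ncol_split_by // Pk /ci; case: eqP; [|case: eqP]; rewrite ?xc //; lia.
have unbalanced (A : {set 'I_N}) : A \subset P -> #|A| != k -> fixsum (split_by x a b A) = 0.
  move=> AP; rewrite neq_ltn => /orP[Ak|]; last exact: big.
  rewrite -split_byC // -/P big ?subsetDl // cardsD (setIidPr AP) Pk; lia.
have := split_trace_sum ab p0P; rewrite (bigID (fun A : {set 'I_N} => #|A| == k)) /=.
rewrite [X in _ + X]big1 => [|A /andP[AP Ak]]; last first.
  by rewrite unbalanced // mxtrace0 mulr0.
rewrite addr0 (eq_bigr (fun A : {set 'I_N} => (-1) ^+ k *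
    (#|[pred g : 'S_N | pull (split_by x a b A) g == split_by x a b A]| *
       \rank (fixsum (split_by x a b A)))%:R)) => [|A /andP[_ /eqP Ak]]; last first.
  by rewrite sgsE Ak fixsum_trace.
rewrite -big_distrr -natr_sum /= => /eqP; rewrite mulf_eq0 signr_eq0 /=.
rewrite (pchar0_natr charF0) sum_nat_eq0 => /forallP/(_ A0).
have A0P : A0 \subset P by apply/subsetP=> p; rewrite !inE => ->.
rewrite A0P A0k eqxx /= muln_eq0 mxrank_eq0.
have -> : split_by x a b A0 = x.
  apply/ffunP=> p; rewrite ffunE !inE.
  by case: (eqVneq (x p) a) => //= _; case: eqP.
rewrite (negPf (fixsum_neq0 fE fx)) orbF.
by have := card_stab_gt0 x; lia.
Qed.

(** Parts 1, 1, 2, ..., r become 2, 2, ..., r, then 1, 3, 3, ..., r, and so on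
    until the part r has grown to r + 1: the colour d i grows to i + 1 and falls
    back to i when d (i + 1) grows, so the net effect is that the additional
    part 1, of colour d 0, is absorbed by d r. *)
Lemma void_absorb c (d : nat -> nat) r : injective d -> c (d 0%N) = 1%N ->
    (forall i, (0 < i <= r)%N -> c (d i) = i) ->
  void (if r is 0 then c else move_box c (d r) (d 0%N)) -> void c.
Proof.
move=> d_inj c0; elim: r => // r IHr ci vr.
have ciS : c (d r.+1) = r.+1 by apply: ci; rewrite ltnS leqnn.
apply: IHr => [i /andP[i_gt0 ir]|]; first by apply: ci; rewrite i_gt0 ltnW.
have dd i j : (d i == d j) = (i == j) by rewrite (inj_eq d_inj).
case: r ciS ci vr => [|r] ciS ci vr.
  by apply: (@void_double _ (d 1%N) (d 0%N) 1%N); rewrite ?dd.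
apply: (@void_double _ (d r.+2) (d r.+1) r.+2); rewrite ?dd ?gtn_eqF //.
- by rewrite /move_box !dd gtn_eqF //= ciS.
- by rewrite /move_box eqxx ci // leqnSn.
apply: eq_void vr => l; rewrite /move_box.
have [->|l2] := eqVneq l (d r.+2); first by rewrite !dd gtn_eqF.
have [->|l1] := eqVneq l (d r.+1); first by rewrite !dd.
by [].
Qed.

(** Staircases are reached from parts 1 by absorption: the staircase k, ..., 1
    grows by one part 1 for each of its parts, in decreasing order, and one
    more part 1 extends it. In this intermediate content the first j of k parts
    have grown, and the colours from k to e - 1 still occur once. *)
Definition growing (k j e : nat) : nat -> nat :=
  fun l => if (l < j)%N then (k.+1 - l)%N else if (l < k)%N then (k - l)%N else (l < e)%N.

Lemma void_grow k j e : (j < k)%N -> (k < e)%N ->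
  void (growing k j.+1 e.-1) -> void (growing k j e).
Proof.
move=> jk ke vg.
pose d i := if i == 0%N then e.-1 else if (i <= k)%N then (k - i)%N else (e + i)%N.
have d_inj : injective d.
  by move=> i i'; rewrite /d; do 2 (case: eqP => ? //; try case: leqP => ?); lia.
apply: (@void_absorb _ d (k - j)) => //.
- by rewrite /d /growing /= ifF ?ifF; lia.
- by move=> i ik; rewrite /d /growing; do !case: ifP; lia.
have d0 : d 0%N = e.-1 by [].
have dr : d (k - j)%N = j by rewrite /d ifF ?ifT; lia.
case E : (k - j)%N => [|r]; first by lia.
rewrite -E dr d0; apply: eq_void vg => l; rewrite /move_box /growing.
have [->|lj] := eqVneq l j; first by rewrite ltnSn ltnn jk; lia.
have [->|le] := eqVneq l e.-1; first by rewrite !ifF; lia.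
by rewrite ltnS leq_eqVlt (negPf lj) /=; do 2!case: ifP => // _; lia.
Qed.

Lemma void_staircase n : N = 'C(n.+1, 2) ->
  void (growing n 0 n) -> void (growing 0 0 N).
Proof.
move=> Nn vn.
have stepN k : 'C(k.+1, 2) = ('C(k, 2) + k)%N by rewrite binS bin1 addnC.
suff main k : (k <= n)%N -> void (growing (n - k) 0 (N - 'C(n - k, 2))).
  by have := main n (leqnn n); rewrite subnn subn0.
elim: k => [_|k IHk kn].
  by rewrite subn0 Nn stepN addKn.
have {IHk} := IHk (ltnW kn); rewrite -(subnSK kn); set i := (n - k.+1)%N.
have Ci : ('C(i.+1, 2) + n <= N)%N.
  by rewrite Nn (stepN n) leq_add2r leq_bin2l // /i; lia.
rewrite (stepN i) in Ci *; set e := (N - 'C(i, 2))%N => vi.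
have in_ : (i < n)%N by rewrite /i; lia.
suff inner j : (j <= i)%N -> void (growing i (i - j) (e - (i - j))).
  by have := inner i (leqnn i); rewrite subnn subn0.
elim: j => [_|j IHj ji].
  rewrite subn0; apply: eq_void vi => l; rewrite /growing /e.
  by do !case: ifP; lia.
apply: void_grow; rewrite ?/e; [lia | lia |].
have -> : (i - j.+1).+1 = (i - j)%N by lia.
have -> : (N - 'C(i, 2) - (i - j.+1)).-1 = (e - (i - j))%N by rewrite /e; lia.
exact: IHj (ltnW ji).
Qed.

Lemma not_void_ones : (0 < m)%N -> ~ void (growing 0 0 N).
Proof.
move=> m_gt0 v; pose y : colouring := [ffun k => val k].
have y1 g : pull y g == y -> g = 1%g.
  move/pull_fixP=> yg; apply/permP=> k; have := yg k.
  by rewrite !ffunE perm1 => /val_inj.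
have [g /y1->|k k_gt0 yk] := @orbit_fun_base _ _ _ rW _ y (const_mx 1).
  by rewrite repr_mx1 mulmx1.
have fy : orbit_fun rW y (const_mx 1) y = 0.
  apply: v; first exact: orbit_fun_equivariant.
  move=> x /orbit_fun_support[g ->] l; rewrite ncol_pull /growing /=.
  have [lN|Nl] := ltnP l N.
    rewrite /= -[RHS](card1 (Ordinal lN)); apply: eq_card => p.
    by rewrite !inE ffunE -(inj_eq val_inj).
  by apply: eq_card0 => p; rewrite !inE ffunE; apply: contraTF Nl => /eqP <-; rewrite -ltnNge; apply: ltn_ord.
move: fy; rewrite yk => /(pchar0_mulrn charF0 k_gt0)/rowP/(_ (Ordinal m_gt0)).
by rewrite !mxE => /eqP; rewrite oner_eq0.
Qed.

End RowInvariants.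

Section StaircaseTensor.

Variables (F : fieldType) (n : nat).
Hypothesis charF0 : [pchar F] =i pred0.
Local Notation N := 'C(n.+1, 2).
Local Notation rho := (staircase n).

Lemma row_invariant_exists m (rW : mx_representation F (symgroup N) m) :
    (0 < m)%N -> (forall x, ~~ odd #[x]%g -> \tr (rW x) = 0) ->
  exists2 w : 'rV[F]_m, w != 0 &
    forall r, r \in row_stab N rho -> w *m rW r = w.
Proof.
move=> m_gt0 even0.
pose y : {ffun 'I_N -> nat} := [ffun k : 'I_N => reshape_index rho k].
have yR g : (pull y g == y) = (g \in row_stab N rho).
  by apply/pull_fixP/row_stabP=> gR k; have := gR k; rewrite !ffunE.
have [y0|] := eqVneq (fixsum rW y) 0; last first.
  case/matrix0Pn=> i [j nz]; exists (row i (fixsum rW y)).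
    by apply: contraNneq nz => /rowP/(_ j); rewrite !mxE => ->.
  by move=> r Rr; rewrite -row_mul fixsum_mul // yR.
case: (not_void_ones charF0 m_gt0 (rW := rW)); apply: (void_staircase charF0 even0 erefl).
move=> f fE fc x; apply/eqP/negPn/negP => fx.
have [l|g xg] := @pull_transitive _ _ y x.
  rewrite (fc x fx).
  have -> : ncol l y = ncol (false, l) (acol (fun p : 'I_N => reshape_index rho p)).
    by apply: eq_card => p; rewrite !inE !ffunE.
  rewrite (@ncol_acol _ n _ (fun p : 'I_N => reshape_offset rho p)).
  - by rewrite /growing /=; do !case: ifP; lia.
  - by move=> p q; apply: cell_inj.
  - exact: staircase_cell_lt.
  exact: staircase_cellP.
move: fx; rewrite xg fE => fx.
suff : f y != 0 by move/(fixsum_neq0 charF0 fE); rewrite y0 eqxx.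
by apply: contraNneq fx => ->; rewrite mul0mx.
Qed.

Lemma ycoef_staircase_tensor m (rL : mx_representation F (symgroup N) m) :
    (0 < m)%N ->
  opf (prod_repr (specht F N rho) (prod_repr (specht F N rho) rL))
      (ycoef rho F) != 0.
Proof.
move=> m_gt0; have rhoN := sumn_staircase n.
pose rW := prod_repr (specht F N rho) rL.
have [||w w_neq0 wR] := row_invariant_exists (rW := rW).
- by rewrite muln_gt0 m_gt0 specht_dim_gt0.
- by move=> x x_even; rewrite mxtrace_prod staircase_char_even_order // mul0r.
apply: (ycoef_tensor charF0 _ wR); first exact: specht_opf_neq0.
exact: staircase_row_to_col.
Qed.

End StaircaseTensor.

Theorem theorem1 (F : fieldType) (charF0 : [pchar F]%R =i pred0)
    (n : nat) (n_gt0 : (0 < n)%N) (sh : seq nat)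
    (sh_part : is_partition 'C(n.+1, 2) sh) :
  is_subrepr (specht F 'C(n.+1, 2) sh)
    (prod_repr (prod_repr (specht F 'C(n.+1, 2) (staircase n))
                          (specht F 'C(n.+1, 2) (staircase n)))
               (specht F 'C(n.+1, 2) (staircase n))).
Proof.
have shN : sumn sh = 'C(n.+1, 2) by case/and3P: sh_part => _ _ /eqP.
have rhoN := sumn_staircase n.
set rho := specht F _ (staircase n); set lam := specht F _ sh.
apply: specht_subrepr => //; rewrite -opf_ycoef_trace //.
(* up to nonzero factors, the traces of both symmetrizers are the sum over x of
   the cube of the character of rho times the character of lam *)
have := ycoef_staircase_tensor charF0 lam (specht_dim_gt0 charF0 shN).
rewrite -opf_ycoef_trace // -/rho.
have nz : #|'S_('C(n.+1, 2))|%:R != 0 :> F.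
  by rewrite (pchar0_natr charF0) -lt0n; apply/card_gt0P; exists 1%g.
apply: contraNneq => tr0; apply/eqP/(mulfI nz); rewrite mulr0.
rewrite opf_ycoef_pairing //; apply/eqP; rewrite mulf_eq0; apply/orP; right.
have := opf_ycoef_pairing charF0 shN (prod_repr (prod_repr rho rho) rho).
rewrite tr0 mulr0 => /esym/eqP; rewrite mulf_eq0 (negPf (yscalar_neq0 charF0 shN)) /=.
rewrite (reindex_inj invg_inj) => /eqP e; apply/eqP; rewrite -[RHS]e.
apply: eq_bigr => x _; rewrite !mxtrace_prod invgK.
have rhoV : \tr (rho x^-1%g) = \tr (rho x) by apply: specht_char_inv.
by rewrite rhoV [RHS]mulrC !mulrA.
Qed.
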